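(* Let $K$ be an algebraically closed field of characteristic $0$ and let $A_1$ be the first Weyl algebra over $K$. The Dixmier conjecture $DC_1$ (every $K$-algebra endomorphism of $A_1$ is an automorphism) holds if and only if for all integers $k,n$ with $k>n\ge1$ one has $A_1(k,n)\cap\Gamma=\emptyset$.
   Context: $A_1$ is the associative $K$-algebra generated by $\mathbf{p},\mathbf{q}$ with relation $[\mathbf{q},\mathbf{p}]=1$; the elements $\mathbf{p}^i\mathbf{q}^j$ ($i,j\ge0$) form a $K$-basis. For $k,n\in\mathbb{Z}_{\ge0}$, $A_1(k,n)$ is the set of $z=\sum a_{ij}\mathbf{p}^i\mathbf{q}^j\in A_1$ with $a_{kn}\ne0$ and $a_{ij}=0$ whenever $i>k$ or $j>n$. $\Gamma=\{z\in A_1\mid \exists\, w\in A_1,\ [z,w]=1\}$. *)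

(* Defs.v *)
From HB Require Import structures.
From mathcomp Require Import all_boot all_order all_algebra.
From mathcomp Require Import boolp classical_sets.
From mathcomp Require Import finmap monalg.

Set Implicit Arguments.
Unset Strict Implicit.
Unset Printing Implicit Defensive.

Import GRing.Theory.
Local Open Scope ring_scope.
Local Open Scope quotient_scope.

(* The free associative algebra K<p, q>, as the monoid algebra of words over
   the two-letter alphabet bool; the letter false is p and the letter true
   is q. *)
Notation free_alg K := {malg K[{fmonom bool}]}.

Definition free_p (K : fieldType) : free_alg K := << fmu false >>.
Definition free_q (K : fieldType) : free_alg K := << fmu true >>.

Definition weyl_relator (K : fieldType) : free_alg K :=
  free_q K * free_p K - free_p K * free_q K - 1.

(* The two-sided ideal generated by [q, p] - 1. *)
Definition weyl_ideal (K : fieldType) : {pred free_alg K} :=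
  fun z => `[< exists s : seq (free_alg K * free_alg K),
                 z = \sum_(c <- s) c.1 * weyl_relator K * c.2 >].
Arguments weyl_ideal : clear implicits.

Lemma sandwich_mulrA (R : pzRingType) (a x r y b : R) :
  a * (x * r * y) * b = a * x * r * (y * b).
Proof. by rewrite !mulrA. Qed.

Section WeylIdeal.
Variable K : fieldType.
Local Notation F := (free_alg K).
Local Notation I := (weyl_ideal K).

Lemma weyl_ideal_zmod_closed : zmod_closed I.
Proof.
split; first by apply/asboolP; exists [::]; rewrite big_nil.
move=> x y /asboolP[s ->] /asboolP[t ->]; apply/asboolP.
exists (s ++ [seq (- c.1, c.2) | c <- t]).
rewrite big_cat big_map -sumrN; congr (_ + _).
by apply: eq_bigr => c _; rewrite !mulNr.
Qed.

HB.instance Definition _ := GRing.isZmodClosed.Build F I weyl_ideal_zmod_closed.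

Lemma weyl_idealM a b z : z \in I -> a * z * b \in I.
Proof.
rewrite !unfold_in; move: (weyl_relator K) => r /asboolP[s ->]; apply/asboolP.
exists [seq (a * c.1, c.2 * b) | c <- s].
rewrite big_map mulr_sumr mulr_suml.
by apply: eq_bigr => c _; apply: sandwich_mulrA.
Qed.

Lemma weyl_relator_in : weyl_relator K \in I.
Proof. by apply/asboolP; exists [:: (1, 1)]; rewrite big_seq1 mul1r mulr1. Qed.

(* The action of K<p, q> on K[X], p by multiplication by 'X and q by
   derivation; used to show that the ideal is proper and that the monomials
   p^i q^j are linearly independent in characteristic 0. *)
Definition letter_act (b : bool) (f : {poly K}) : {poly K} :=
  if b then f^`() else 'X * f.

Definition word_act (w : {fmonom bool}) (f : {poly K}) : {poly K} :=
  foldr letter_act f (w : seq bool).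

Definition free_act (g : F) (f : {poly K}) : {poly K} :=
  mmap (@polyC K) (word_act^~ f) g.

Lemma word_act_linear w : linear (word_act w).
Proof.
rewrite /word_act => a f g; elim: (w : seq bool) => //= -[] s -> /=.
  by rewrite derivD derivZ.
by rewrite mulrDr scalerAr.
Qed.

HB.instance Definition _ w :=
  GRing.isLinear.Build K {poly K} {poly K} _ (word_act w) (word_act_linear w).

Lemma free_actU c w f : free_act << c *g w >> f = c *: word_act w f.
Proof. by rewrite /free_act mmapU mul_polyC. Qed.

Lemma free_actD g h f : free_act (g + h) f = free_act g f + free_act h f.
Proof. exact: raddfD. Qed.

Lemma free_actB g h f : free_act (g - h) f = free_act g f - free_act h f.
Proof. exact: raddfB. Qed.

Lemma free_act0 f : free_act 0 f = 0.
Proof. exact: raddf0. Qed.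

Lemma free_act_sum (J : Type) (s : seq J) (G : J -> F) f :
  free_act (\sum_(i <- s) G i) f = \sum_(i <- s) free_act (G i) f.
Proof. exact: raddf_sum. Qed.

Lemma word_actM w1 w2 f :
  word_act (mmul w1 w2) f = word_act w1 (word_act w2 f).
Proof. by rewrite /word_act fmM foldr_cat. Qed.

Lemma free_actE g f :
  free_act g f = \sum_(w <- msupp g) g@_w *: word_act w f.
Proof. by apply: eq_bigr => w _; rewrite mul_polyC. Qed.

Lemma free_actM g h f : free_act (g * h) f = free_act g (free_act h f).
Proof.
rewrite malgME free_act_sum free_actE; apply: eq_bigr => w1 _.
rewrite free_act_sum (free_actE h) linear_sum scaler_sumr.
apply: eq_bigr => w2 _.
by rewrite free_actU word_actM linearZ scalerA.
Qed.

Lemma free_act1 f : free_act 1 f = f.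
Proof. by rewrite /free_act mmapU /word_act fm1 mul1r. Qed.

Lemma free_act_p f : free_act (free_p K) f = 'X * f.
Proof. by rewrite free_actU scale1r /word_act fmU. Qed.

Lemma free_act_q f : free_act (free_q K) f = f^`().
Proof. by rewrite free_actU scale1r /word_act fmU. Qed.

Lemma free_act_relator f : free_act (weyl_relator K) f = 0.
Proof.
rewrite /weyl_relator; move: (free_act_p) (free_act_q).
move: (free_p K) (free_q K) => p q actp actq.
rewrite (free_actB (q * p - p * q)) (free_actB (q * p)) free_act1.
transitivity (free_act q (free_act p f) - free_act p (free_act q f) - f).
  by congr (_ - _ - _); apply: free_actM.
by rewrite !actp !actq derivM derivX mul1r addrK subrr.
Qed.

Lemma free_actr0 g : free_act g 0 = 0.
Proof. by rewrite free_actE big1 // => w _; rewrite linear0 scaler0. Qed.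

Lemma free_act_ideal z f : z \in I -> free_act z f = 0.
Proof.
move: (free_act_relator); rewrite unfold_in /weyl_ideal.
move: (weyl_relator K) => r actr /asboolP[s ->].
rewrite free_act_sum big1 // => c _.
by rewrite -mulrA !free_actM actr free_actr0.
Qed.

Lemma weyl_ideal_proper : 1 \notin I.
Proof.
apply/negP => /(@free_act_ideal _ 1); rewrite free_act1 => /eqP.
by rewrite oner_eq0.
Qed.


End WeylIdeal.

Definition weyl (K : fieldType) := Quotient.quot (weyl_ideal K).

Section WeylAlgebra.
Variable K : fieldType.
Local Notation F := (free_alg K).
Local Notation A := (weyl K).

HB.instance Definition _ := GRing.Zmodule.on A.

Definition weyl_pi (z : F) : A := \pi_A z.

Lemma weyl_piP x y : reflect (weyl_pi x = weyl_pi y) (x - y \in weyl_ideal K).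
Proof. by rewrite Quotient.idealrBE; apply: eqP. Qed.

Lemma weyl_piK (z : A) : weyl_pi (repr z) = z.
Proof. exact: reprK. Qed.

Lemma weyl_piD : {morph weyl_pi : x y / x + y}.
Proof. by move=> x y; rewrite /weyl_pi [LHS]raddfD. Qed.

Lemma weyl_piB : {morph weyl_pi : x y / x - y}.
Proof. by move=> x y; rewrite /weyl_pi [LHS]raddfB. Qed.

Definition weyl_one : A := weyl_pi 1.
Definition weyl_mul (x y : A) : A := weyl_pi (repr x * repr y).
Definition weyl_scale (c : K) (x : A) : A := weyl_pi (c *: repr x).

Lemma weyl_piM x y : weyl_pi (x * y) = weyl_mul (weyl_pi x) (weyl_pi y).
Proof.
apply/weyl_piP; set x' := repr _; set y' := repr _.
have -> : x * y - x' * y' = 1 * (x - x') * y + x' * (y - y') * 1.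
  by rewrite mul1r mulr1 mulrBl mulrBr addrA subrK.
by apply: rpredD; apply: weyl_idealM; apply/weyl_piP; rewrite weyl_piK.
Qed.

Lemma weyl_piZ c x : weyl_pi (c *: x) = weyl_scale c (weyl_pi x).
Proof.
apply/weyl_piP; set x' := repr _.
have -> : c *: x - c *: x' = (c *: 1) * (x - x') * 1.
  by rewrite mulr1 -scalerAl mul1r scalerBr.
by apply: weyl_idealM; apply/weyl_piP; rewrite weyl_piK.
Qed.

Lemma weyl_mulA : associative weyl_mul.
Proof.
by move=> x y z; rewrite -[x]weyl_piK -[y]weyl_piK -[z]weyl_piK -!weyl_piM mulrA.
Qed.

Lemma weyl_mul1 : left_id weyl_one weyl_mul.
Proof. by move=> x; rewrite -[x]weyl_piK -weyl_piM mul1r. Qed.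

Lemma weyl_mulr1 : right_id weyl_one weyl_mul.
Proof. by move=> x; rewrite -[x]weyl_piK -weyl_piM mulr1. Qed.

Lemma weyl_mulDl : left_distributive weyl_mul +%R.
Proof.
move=> x y z; rewrite -[x]weyl_piK -[y]weyl_piK -[z]weyl_piK.
by rewrite -weyl_piD -!weyl_piM -weyl_piD mulrDl.
Qed.

Lemma weyl_mulDr : right_distributive weyl_mul +%R.
Proof.
move=> x y z; rewrite -[x]weyl_piK -[y]weyl_piK -[z]weyl_piK.
by rewrite -weyl_piD -!weyl_piM -weyl_piD mulrDr.
Qed.

Lemma weyl_one_neq0 : weyl_one != 0.
Proof.
have -> : 0 = weyl_pi 0 by rewrite /weyl_pi raddf0.
apply/eqP => /weyl_piP; rewrite subr0; apply/negP.
exact: weyl_ideal_proper.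
Qed.

HB.instance Definition _ := GRing.Zmodule_isNzRing.Build A
  weyl_mulA weyl_mul1 weyl_mulr1 weyl_mulDl weyl_mulDr weyl_one_neq0.

Lemma weyl_scaleA a b x : weyl_scale a (weyl_scale b x) = weyl_scale (a * b) x.
Proof. by rewrite -[x]weyl_piK -!weyl_piZ scalerA. Qed.

Lemma weyl_scale1 : left_id 1 weyl_scale.
Proof. by move=> x; rewrite -[x]weyl_piK -weyl_piZ scale1r. Qed.

Lemma weyl_scaleDr : right_distributive weyl_scale +%R.
Proof.
move=> a x y; rewrite -[x]weyl_piK -[y]weyl_piK.
by rewrite -weyl_piD -!weyl_piZ -weyl_piD scalerDr.
Qed.

Lemma weyl_scaleDl x : {morph weyl_scale^~ x : a b / a + b}.
Proof.
by move=> a b; rewrite -[x]weyl_piK -!weyl_piZ -weyl_piD scalerDl.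
Qed.

HB.instance Definition _ := GRing.Zmodule_isLmodule.Build K A
  weyl_scaleA weyl_scale1 weyl_scaleDr weyl_scaleDl.

Lemma free_scalerAr (c : K) (x y : F) : c *: (x * y) = x * (c *: y).
Proof.
have scaleU a w : c *: << a *g w >> = << c * a *g w >> :> F.
  by apply/malgP => w'; rewrite mcoeffZ !mcoeffU mulrnAr.
rewrite malgME (malgMEw (fsubset_refl _) (msuppZ_le c y)) scaler_sumr.
apply: eq_bigr => w1 _; rewrite scaler_sumr; apply: eq_bigr => w2 _.
by rewrite scaleU (mcoeffZ c y) mulrCA.
Qed.

Lemma weyl_scaleAl (c : K) (x y : A) : c *: (x * y) = (c *: x) * y.
Proof.
rewrite -[x]weyl_piK -[y]weyl_piK -[LHS]/(weyl_scale _ (weyl_mul _ _)).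
by rewrite -[RHS]/(weyl_mul (weyl_scale _ _) _) -!(weyl_piM, weyl_piZ) scalerAl.
Qed.

HB.instance Definition _ := GRing.Lmodule_isLalgebra.Build K A weyl_scaleAl.

Lemma weyl_scaleAr (c : K) (x y : A) : c *: (x * y) = x * (c *: y).
Proof.
rewrite -[x]weyl_piK -[y]weyl_piK -[LHS]/(weyl_scale _ (weyl_mul _ _)).
rewrite -[RHS]/(weyl_mul _ (weyl_scale _ _)) -!(weyl_piM, weyl_piZ).
by rewrite free_scalerAr.
Qed.

HB.instance Definition _ := GRing.Lalgebra_isAlgebra.Build K A weyl_scaleAr.

Definition weyl_p : A := weyl_pi (free_p K).
Definition weyl_q : A := weyl_pi (free_q K).

Definition weyl_comm (x y : A) : A := x * y - y * x.

Lemma weyl_comm_qp : weyl_comm weyl_q weyl_p = 1.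
Proof.
rewrite /weyl_comm -[_ * _]weyl_piM -[weyl_p * _]weyl_piM -weyl_piB.
by apply/weyl_piP/weyl_relator_in.
Qed.

Definition weyl_sum m n (a : nat -> nat -> K) : A :=
  \sum_(i < m) \sum_(j < n) a i j *: (weyl_p ^+ i * weyl_q ^+ j).

Lemma weyl_sum_free m n a : [pchar K] =i pred0 -> weyl_sum m n a = 0 ->
  forall i j, (i < m)%N -> (j < n)%N -> a i j = 0.
Proof.
move=> /pcharf0P charK.
pose g : F := \sum_(i < m) \sum_(j < n) a i j *: (free_p K ^+ i * free_q K ^+ j).
have pi_sum (n' : nat) (G : 'I_n' -> F) :
    weyl_pi (\sum_i G i) = \sum_i weyl_pi (G i).
  by apply: (big_morph weyl_pi weyl_piD); rewrite /weyl_pi raddf0.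
have piX z i : weyl_pi (z ^+ i) = weyl_pi z ^+ i.
  by elim: i => // i IHi; rewrite !exprS weyl_piM IHi.
have -> : weyl_sum m n a = weyl_pi g.
  rewrite /g pi_sum; apply: eq_bigr => i _; rewrite pi_sum.
  by apply: eq_bigr => j _; rewrite weyl_piZ weyl_piM !piX.
have -> : 0 = weyl_pi 0 by rewrite /weyl_pi raddf0.
move=> /weyl_piP; rewrite subr0 => gI.
have actZ c h f : free_act (c *: h) f = c *: free_act h f.
  by rewrite -mul_malgC free_actM free_actU /word_act fm1.
have actp i f : free_act (free_p K ^+ i) f = 'X^i * f.
  elim: i => [|i IHi]; first by rewrite free_act1 mul1r.
  by rewrite !exprS free_actM IHi free_act_p mulrA.
have actq j f : free_act (free_q K ^+ j) f = f^`(j).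
  elim: j => [|j IHj]; first by rewrite free_act1.
  by rewrite exprS free_actM IHj free_act_q.
have actg f : \sum_(i < m) \sum_(j < n) a i j *: ('X^i * f^`(j)) = 0.
  rewrite -[RHS](free_act_ideal f gI) /g free_act_sum; apply: eq_bigr => i _.
  rewrite free_act_sum; apply: eq_bigr => j _.
  by rewrite actZ free_actM actq actp.
move=> i j lt_im; elim/ltn_ind: j i lt_im => j IHj i lt_im lt_jn.
have := congr1 (fun f : {poly K} => f`_i) (actg 'X^j).
rewrite coef0 coef_sum (bigD1 (Ordinal lt_im)) //= coef_sum.
rewrite (bigD1 (Ordinal lt_jn)) //= derivnXn subnn ffactnn expr0.
rewrite coefZ mulrnAr mulr1 coefMn coefXn eqxx.
rewrite !big1 ?addr0.
- move/eqP; rewrite mulf_eq0 => /orP[/eqP //|].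
  by rewrite charK => /eqP; have := fact_gt0 j; case: (j`!).
- move=> k neq_ki; rewrite coef_sum big1 // => l _; rewrite derivnXn.
  case: (ltngtP l j) => [lt_lj|lt_jl|eq_lj].
  + by rewrite IHj // scale0r coef0.
  + by rewrite ffact_small // mulr0n mulr0 scaler0 coef0.
  rewrite eq_lj subnn expr0 coefZ mulrnAr mulr1 coefMn coefXn.
  case: eqP => [eq_ik|]; last by rewrite mul0rn mulr0.
  by case/eqP: neq_ki; apply/val_inj.
move=> l neq_lj; rewrite derivnXn.
case: (ltngtP l j) => [lt_lj|lt_jl|eq_lj].
- by rewrite IHj // scale0r coef0.
- by rewrite ffact_small // mulr0n mulr0 scaler0 coef0.
by case/eqP: neq_lj; apply/val_inj.
Qed.

(* By weyl_sum_free, in characteristic 0 the coefficients of z on the monomials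
   p^i q^j are unique, so the existential picks out the coefficients of z; those
   with k < i or n < j vanish because the sum does not reach them. *)
Definition weyl_box (k n : nat) : set A :=
  [set z | exists a : nat -> nat -> K,
     a k n != 0 /\ z = weyl_sum k.+1 n.+1 a].

Definition weyl_Gamma : set A := [set z | exists w : A, weyl_comm z w = 1].

End WeylAlgebra.

Arguments weyl_p K : clear implicits.
Arguments weyl_q K : clear implicits.
Arguments weyl_box K k n : clear implicits.
Arguments weyl_Gamma K : clear implicits.

Definition dixmier_conjecture (K : fieldType) : Prop :=
  forall f : {lrmorphism weyl K -> weyl K}, bijective f.

(* Main.v *)
(* Let z = f(q) for an endomorphism f. For a weight (r, s) on (p, q), let F be the
   leading form of z. The image of f has quadratic growth, whereas forms that
   Poisson-commute with F are determined up to a scalar by their degree; hence some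
   u in the image has a leading form H with {F, H} <> 0. Choosing u of minimal
   ad z-nilpotency order, E = {F, H} does commute with F, and comparing
   multiplicities of roots shows that E divides F H. So G = F H / E is a form of
   weight r + s with {F, G} = F (up to sign), which leaves very few shapes for F:
   - in weight (1, 1), after shears and the swap q -> p, p -> -q, the form F is
     x^a y^b with a > b;
   - then no edge of the Newton polygon leaves (a, b) to the right, and one going up
     can occur only for b = 0 and weight (1, s), where a shear q -> q + c p^s lowers
     the total degree of z.
   So either z reaches the box (a, b) with a > b >= 1, or z becomes a polynomial in
   p, and then z is linear and f is surjective.
   Conversely, if f is an automorphism then ad z is locally nilpotent, while for z
   in the box (k, n) with k > n >= 1 the leading monomials of (ad z)^m p never
   vanish. *)

Require Import Defs.
From HB Require Import structures.
From mathcomp Require Import all_boot all_order all_algebra.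
From mathcomp Require Import boolp classical_sets.
From mathcomp Require Import finmap monalg.
From mathcomp Require Import ring zify.

Set Implicit Arguments.
Unset Strict Implicit.
Unset Printing Implicit Defensive.

Import GRing.Theory.
Local Open Scope ring_scope.

(** * Universal property and normal ordering *)

Section WeylEval.
Variables (K : fieldType) (z w : weyl K).
Hypothesis comm_zw : weyl_comm z w = 1.
Local Notation F := (free_alg K).

Definition word_val (m : {fmonom bool}) : weyl K :=
  \prod_(b <- (m : seq bool)) (if b then z else w).

Lemma word_val_mmorphism : mmorphism word_val.
Proof.
by split=> [m1 m2|]; rewrite /word_val ?fmM ?big_cat // fm1 big_nil.
Qed.

HB.instance Definition _ := 
  monalg.isMultiplicative.Build _ (weyl K) word_val word_val_mmorphism.

Definition free_val (g : F) : weyl K := mmap (in_alg (weyl K)) word_val g.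

Lemma free_valM : {morph free_val : g h / g * h}.
Proof.
have comm_g (g : F) m m' : GRing.comm (in_alg (weyl K) g@_m) (word_val m').
  exact: comm_alg.
exact: (commr_mmap_is_multiplicative comm_g).1.
Qed.

Lemma free_val1 : free_val 1 = 1. Proof. exact: mmap1. Qed.

Lemma free_valB : {morph free_val : g h / g - h}.
Proof. by move=> g h; apply: raddfB. Qed.

Lemma free_val_sum (J : Type) (s : seq J) (G : J -> F) :
  free_val (\sum_(i <- s) G i) = \sum_(i <- s) free_val (G i).
Proof. exact: raddf_sum. Qed.

Lemma free_valZ c g : free_val (c *: g) = c *: free_val g.
Proof. by rewrite /free_val mmapZ /= -scalerAl mul1r. Qed.

Lemma free_val_p : free_val (free_p K) = w.
Proof. by rewrite /free_val mmapU /word_val fmU big_seq1 /= scale1r mul1r. Qed.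

Lemma free_val_q : free_val (free_q K) = z.
Proof. by rewrite /free_val mmapU /word_val fmU big_seq1 /= scale1r mul1r. Qed.

Lemma free_val_relator : free_val (weyl_relator K) = 0.
Proof.
rewrite /weyl_relator; move: free_val_p free_val_q.
move: (free_p K) (free_q K) => p q valp valq.
rewrite (free_valB (q * p - p * q)) (free_valB (q * p)) free_val1.
transitivity (free_val q * free_val p - free_val p * free_val q - 1).
  by congr (_ - _ - _); apply: free_valM.
by rewrite valp valq -[z * w - w * z]/(weyl_comm z w) comm_zw subrr.
Qed.

Lemma free_val_ideal g : g \in weyl_ideal K -> free_val g = 0.
Proof.
move: free_val_relator; rewrite unfold_in /weyl_ideal.
move: (weyl_relator K) => r r0 /asboolP[s ->].
rewrite free_val_sum; apply: big1 => -[a b] _ /=.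
by rewrite (free_valM (a * r) b) (free_valM a r) r0 mulr0 mul0r.
Qed.

Definition weyl_eval (u : weyl K) : weyl K := free_val (repr u).

Lemma weyl_eval_pi g : weyl_eval (weyl_pi g) = free_val g.
Proof.
apply/eqP; rewrite -subr_eq0 -free_valB; apply/eqP/free_val_ideal/weyl_piP.
by rewrite weyl_piK.
Qed.

Lemma weyl_eval_is_additive : zmod_morphism weyl_eval.
Proof.
move=> x y; rewrite -[x]weyl_piK -[y]weyl_piK -weyl_piB !weyl_eval_pi.
exact: free_valB.
Qed.

Lemma weyl_eval_is_multiplicative : monoid_morphism weyl_eval.
Proof.
split; first by rewrite -[1]/(weyl_pi 1) weyl_eval_pi free_val1.
move=> x y; rewrite -[x]weyl_piK -[y]weyl_piK.
by rewrite -[_ * _]/(weyl_mul _ _) -weyl_piM !weyl_eval_pi free_valM.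
Qed.

Lemma weyl_eval_is_scalable : scalable weyl_eval.
Proof.
move=> c x; rewrite -[x]weyl_piK -[c *: _]/(weyl_scale _ _) -weyl_piZ.
by rewrite !weyl_eval_pi free_valZ.
Qed.

HB.instance Definition _ :=
  GRing.isZmodMorphism.Build (weyl K) (weyl K) weyl_eval weyl_eval_is_additive.
HB.instance Definition _ :=
  GRing.isMonoidMorphism.Build (weyl K) (weyl K) weyl_eval weyl_eval_is_multiplicative.
HB.instance Definition _ :=
  GRing.isScalable.Build K (weyl K) (weyl K) _ weyl_eval weyl_eval_is_scalable.

Lemma weyl_hom_exists :
  exists f : {lrmorphism weyl K -> weyl K}, f (weyl_q K) = z /\ f (weyl_p K) = w.
Proof.
exists weyl_eval; split; first by rewrite /= weyl_eval_pi free_val_q.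
by rewrite /= weyl_eval_pi free_val_p.
Qed.

End WeylEval.

Section NormalOrdering.
Variables (R : pzRingType) (p q : R).
Hypothesis comm_qp : q * p - p * q = 1.

Lemma mulqpX k : q * p ^+ k = p ^+ k * q + p ^+ k.-1 *+ k.
Proof.
have qp : q * p = p * q + 1 by rewrite -comm_qp addrC subrK.
elim: k => [|k IHk]; first by rewrite mulr1 mul1r addr0.
rewrite exprSr mulrA IHk mulrDl -mulrA qp mulrDr mulr1 mulrA -addrA.
congr (_ + _); rewrite mulrS mulrnAl; congr (_ + _).
by case: k {IHk} => // k; rewrite /= -exprSr.
Qed.

(** The Leibniz rule, with q differentiating in p; the induction on j is Pascal's rule. *)
Lemma mulqXpX j k : q ^+ j * p ^+ k =
  \sum_(t < j.+1) (p ^+ (k - t) * q ^+ (j - t)) *+ ('C(j, t) * k ^_ t).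
Proof.
elim: j => [|j IHj]; first by rewrite big_ord1 !mul1r !subn0 mulr1.
rewrite exprS -mulrA IHj mulr_sumr.
transitivity (\sum_(t < j.+1) (p ^+ (k - t) * q ^+ (j.+1 - t)) *+ ('C(j, t) * k ^_ t)
  + \sum_(t < j.+1) (p ^+ (k - t.+1) * q ^+ (j - t)) *+ ('C(j, t) * k ^_ t.+1)).
  rewrite -big_split; apply: eq_bigr => -[t /= lt_tj] _.
  rewrite mulrnAr mulrA mulqpX mulrDl mulrnDl -mulrA -exprS subSn //; congr (_ + _).
  by rewrite mulrnAl -mulrnA subnS ffactnSr; congr (_ *+ _); lia.
rewrite [in RHS]big_ord_recl [X in X + _ = _]big_ord_recl -addrA.
congr (_ + _); first by rewrite !bin0.
rewrite [X in _ = X]big_ord_recr [X in _ + X = _]big_ord_recr /= addrA.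
rewrite [bump 0 j]add1n !subSS !subnn !binn; congr (_ + _).
  rewrite -big_split /=; apply: eq_bigr => -[t /= lt_tj] _.
  by rewrite [bump 0 t]add1n subSS -mulrnDr -mulnDl binS addnC.
Qed.

End NormalOrdering.

Section WeylInd.
Variable K : fieldType.
Local Notation p := (weyl_p K).
Local Notation q := (weyl_q K).

(** Words span the free algebra and arise from 1 by multiplying letters on the left. *)
Lemma weyl_ind (P : weyl K -> Prop) :
  P 1 -> (forall u v, P u -> P v -> P (u + v)) ->
  (forall c u, P u -> P (c *: u)) ->
  (forall u, P u -> P (p * u)) -> (forall u, P u -> P (q * u)) ->
  forall u, P u.
Proof.
move=> P1 PD PZ Pp Pq u; rewrite -[u]weyl_piK; move: (repr u) => g.
have P0 : P 0 by rewrite -(scale0r 1); apply: PZ.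
have Pw (m : seq bool) : P (weyl_pi << fmonom_of_seq fmonom_key m >>).
  elim: m => [|b m IHm]; first by rewrite fmE -fmoneE.
  have -> : fmonom_of_seq fmonom_key (b :: m) =
      mmul (fmu b) (fmonom_of_seq fmonom_key m).
    by rewrite /mmul /= fmmulE fmuE !fmE.
  have -> : << mmul (fmu b) (fmonom_of_seq fmonom_key m) >> =
      << fmu b >> * << fmonom_of_seq fmonom_key m >> :> free_alg K.
    by rewrite [RHS]fgmulUU mul1r.
  by rewrite weyl_piM; case: b; [apply: Pq | apply: Pp].
rewrite (monalgE g).
elim/big_rec: _ => [|m x _ Px]; first by rewrite /weyl_pi raddf0.
rewrite weyl_piD; apply: PD => //.
have -> : << g@_m *g m >> = g@_m *: << m >> :> free_alg K.
  by apply/malgP => m'; rewrite mcoeffZ !mcoeffU mulrnAr mulr1.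
rewrite weyl_piZ; apply: PZ; rewrite -[m]fmK -fmE; exact: Pw.
Qed.

End WeylInd.

(** * Dehomogenised Poisson bracket *)

Section Bracket.
Variable K : fieldType.
Implicit Types f g h : {poly K}.

(* The Poisson bracket F_y H_x - F_x H_y of forms F, H of weighted degrees d, e,
   multiplied by the weight of x and dehomogenised at x = 1 (Euler's identity). *)
Definition bracket (d : nat) f (e : nat) h : {poly K} :=
  f^`() * h *+ e - f * h^`() *+ d.

Lemma bracketE d f e h :
  bracket d f e h = f^`() * h * e%:R - f * h^`() * d%:R.
Proof. by rewrite !mulr_natr. Qed.

Lemma bracketZr d f e c h : bracket d f e (c *: h) = c *: bracket d f e h.
Proof. by rewrite /bracket derivZ -!scalerAr !scalerMnr -scalerBr. Qed.

Lemma bracket_monomial d e n l (c c' : K) : (0 < n)%N ->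
  bracket d (c *: 'X^n) e (c' *: 'X^l) =
  (c * c' * ((n * e)%:R - (l * d)%:R)) *: 'X^((n + l).-1).
Proof.
move=> n0; rewrite /bracket !derivZ !derivXn -!scalerMnr mulrnAl mulrnAr.
rewrite -!scalerAl -!scalerAr !scalerA -!exprD -!mulrnA.
have -> : c * c' *: 'X^(n + l.-1) *+ (l * d) = c * c' *: 'X^((n + l).-1) *+ (l * d).
  by case: l => [|l]; rewrite ?mul0n ?mulr0n // addnS.
have -> : (n.-1 + l = (n + l).-1)%N by lia.
by rewrite !scalerMnl -scalerBl mulrBr !mulr_natr.
Qed.

Hypothesis charK : [pchar K] =i pred0.

Lemma natr_eq0 n : (n%:R == 0 :> K) = (n == 0)%N.
Proof. by move/pcharf0P: charK. Qed.

Lemma natr_inj m n : (m%:R == n%:R :> K) = (m == n).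
Proof.
wlog le : m n / (m <= n)%N => [H|].
  by case/orP: (leq_total m n) => /H // E; rewrite eq_sym E eq_sym.
by rewrite eq_sym -subr_eq0 -natrB // natr_eq0 subn_eq0 eqn_leq le.
Qed.

Lemma coefM_top f g m l : (size f <= m.+1)%N -> (size g <= l.+1)%N ->
  (f * g)`_(m + l) = f`_m * g`_l.
Proof.
move=> sf sg; rewrite coefM.
have ltm : (m < (m + l).+1)%N by lia.
rewrite (bigD1 (Ordinal ltm)) //= addKn big1 ?addr0 // => -[i /= lti].
rewrite -val_eqE /= => nei; have [lt|le] := ltnP m i.
  by rewrite nth_default ?mul0r //; apply: leq_trans sf lt.
by rewrite [X in _ * X]nth_default ?mulr0 //; apply: leq_trans sg _; lia.
Qed.

Lemma coef_mulX_deriv f j : ('X * f^`())`_j = f`_j *+ j.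
Proof. by rewrite coefXM; case: j => [|j] /=; rewrite ?mulr0n // coef_deriv. Qed.

Lemma size_mulX_deriv f : (size ('X * f^`())%R <= size f)%N.
Proof. by apply/leq_sizeP => j le; rewrite coef_mulX_deriv nth_default // mul0rn. Qed.

(** Multiplying by ['X] replaces the derivative by an operator that is diagonal on monomials, so the
    top coefficients simply multiply. *)
Lemma coef_bracket_top d f e h m l : (size f <= m.+1)%N -> (size h <= l.+1)%N ->
  ('X * bracket d f e h)`_(m + l) = f`_m * h`_l * ((e * m)%:R - (d * l)%:R).
Proof.
move=> sf sh.
have -> : 'X * bracket d f e h = ('X * f^`()) * h *+ e - f * ('X * h^`()) *+ d.
  by rewrite /bracket mulrBr !mulrnAr; congr (_ *+ _ - _ *+ _); [apply: mulrA | apply: mulrCA].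
rewrite coefB !coefMn !coefM_top //; try by apply: leq_trans (size_mulX_deriv _) _.
by rewrite !coef_mulX_deriv mulrnAl mulrnAr -!mulrnA mulrBr !mulr_natr mulnC [(l * d)%N]mulnC.
Qed.

(** The top coefficient has to vanish: Poisson-commuting forms have y-degrees proportional to their
    weights. *)
Lemma bracket0_size d f e h : f != 0 -> h != 0 -> bracket d f e h = 0 ->
  (e * (size f).-1 = d * (size h).-1)%N.
Proof.
move=> f0 h0 b0.
have := @coef_bracket_top d f e h (size f).-1 (size h).-1.
rewrite b0 mulr0 coef0 !prednK ?size_poly_gt0 // => /(_ (leqnn _) (leqnn _))/esym/eqP.
by rewrite !mulf_eq0 !lead_coef_eq0 (negbTE f0) (negbTE h0) /= subr_eq0 natr_inj => /eqP.
Qed.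

Lemma bracket_size d f e h : (e * (size f).-1 != d * (size h).-1)%N ->
  f != 0 -> h != 0 -> ((size f).-1 + (size h).-1 <= size (bracket d f e h))%N.
Proof.
move=> ne f0 h0.
have := @coef_bracket_top d f e h (size f).-1 (size h).-1.
rewrite !prednK ?size_poly_gt0 // => /(_ (leqnn _) (leqnn _)).
have [lt|//] := ltnP; rewrite nth_default => [/esym/eqP|].
  rewrite !mulf_eq0 !lead_coef_eq0 (negbTE f0) (negbTE h0) /= subr_eq0 natr_inj.
  by rewrite (negbTE ne).
by apply: leq_trans (size_polyMleq _ _) _; rewrite size_polyX /=.
Qed.

(** The local counterpart of [coef_bracket_top] at [x]: up to higher order, ['X - x%:P] times the
    derivative multiplies a polynomial by its multiplicity at [x]. *)
Lemma bracket_root x d f e h : f != 0 -> h != 0 -> exists k,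
  ('X - x%:P) * bracket d f e h = ('X - x%:P) ^+ (mup x f + mup x h) * k /\
  ((k.[x] == 0) = (e * mup x f == d * mup x h)%N).
Proof.
move=> f0 h0; set Y := 'X - x%:P.
have mupE g : g != 0 -> exists2 g1, ~~ root g1 x & g = g1 * Y ^+ mup x g.
  move=> g0; have [m [g1]] := multiplicity_XsubC g x; rewrite g0 /= => g1x E.
  exists g1 => //; rewrite {1}E {1}E mupMr // mup_XsubCX eqxx //.
have YderivE g1 m : Y * (g1 * Y ^+ m)^`() = Y ^+ m * (g1 *+ m + Y * g1^`()).
  rewrite derivM deriv_exp derivXsubC mul1r.
  case: m => [|m] /=; first by rewrite !expr0 !mulr0n mulr0 addr0 mulr1 mul1r add0r.
  rewrite !mulrDr addrC; congr (_ + _); last first.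
    by rewrite [LHS]mulrA [LHS]mulrC.
  by rewrite !mulrnAr [g1 * _]mulrC mulrA -exprS.
have [f1 f1x fE] := mupE f f0; have [h1 h1x hE] := mupE h h0.
set m := mup x f in fE *; set l := mup x h in hE *.
have Yf : Y * f^`() = Y ^+ m * (f1 *+ m + Y * f1^`()) by rewrite {1}fE YderivE.
have Yh : Y * h^`() = Y ^+ l * (h1 *+ l + Y * h1^`()) by rewrite {1}hE YderivE.
exists ((f1 *+ m + Y * f1^`()) * h1 *+ e - f1 * (h1 *+ l + Y * h1^`()) *+ d); split.
  transitivity (Y * f^`() * h *+ e - f * (Y * h^`()) *+ d).
    by rewrite /bracket mulrBr !mulrnAr; congr (_ *+ _ - _ *+ _); [apply: mulrA | apply: mulrCA].
  rewrite Yf Yh; clearbody m l; rewrite fE hE exprD mulrBr !mulrnAr; congr (_ *+ _ - _ *+ _).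
    by rewrite [h1 * _]mulrC mulrACA.
  by rewrite [f1 * _]mulrC mulrACA.
rewrite /Y !(hornerE, hornerMn) subrr !mul0r !addr0.
rewrite mulrnAl mulrnAr -!mulrnA -mulr_natr -[X in _ - X]mulr_natr -mulrBr.
move: f1x h1x; rewrite /root => /negbTE f1x /negbTE h1x.
by rewrite !mulf_eq0 f1x h1x subr_eq0 natr_inj mulnC [(l * d)%N]mulnC.
Qed.

(** The bracket with f is a derivation: {f, eps g} = eps {f, g} because {f, eps} = 0, while {f, f h}
    = f {f, h} = f eps. The condition on weights gives eps g and f h the same weight. *)
Lemma bracket_quotient_eq d f e h e' n g :
  let eps := bracket d f e h in
  eps != 0 -> bracket d f e' eps = 0 -> (e' + n = d + e)%N ->
  eps * g = f * h -> bracket d f n g = f.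
Proof.
move=> eps eps0 comm_eps En E; apply: (mulfI eps0).
have H1 : eps^`() * g + eps * g^`() = f^`() * h + f * h^`().
  by rewrite -!derivM E.
have H2 : f^`() * eps * e'%:R = f * eps^`() * d%:R.
  by apply/eqP; rewrite -subr_eq0 !mulr_natr; apply/eqP.
have H3 : eps = f^`() * h * e%:R - f * h^`() * d%:R by rewrite !mulr_natr.
have H5 : e'%:R + n%:R = d%:R + e%:R :> {poly K} by rewrite -!natrD En.
rewrite bracketE.
move: (f^`()) (h^`()) (eps^`()) (g^`()) (d%:R : {poly K}) (e%:R : {poly K})
  (e'%:R : {poly K}) (n%:R : {poly K}) H1 H2 H3 H5 E.
move: eps {eps0 comm_eps} => eps f' h' eps' g' D E0 E' N H1 H2 H3 H5 E.
have NE : N = D + E0 - E' by rewrite -H5; ring.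
have -> : eps * (f' * g * N - f * g' * D) = N * f' * (eps * g) - D * f * (eps * g') by ring.
have -> : eps * g' = f' * h + f * h' - eps' * g by rewrite -H1; ring.
have -> : D * f * (f' * h + f * h' - eps' * g) =
  D * f * (f' * h + f * h') - (f * eps' * D) * g by ring.
rewrite -H2 E.
have -> : f' * eps * E' * g = f' * E' * (eps * g) by ring.
rewrite E H3 NE; ring.
Qed.

Lemma bracket_neq0 d f e h : bracket d f e h != 0 -> f != 0 /\ h != 0.
Proof.
move=> nz; split; apply: contraNneq nz => ->; rewrite /bracket deriv0.
  by rewrite !mul0r !mul0rn subrr.
by rewrite !mulr0 !mul0rn subrr.
Qed.

(** If the top terms of f and h do not cancel in the bracket, then deg eps >= deg f + deg h - 1, so
    deg g <= 1. Otherwise the degrees of f, h and eps are all proportional to their weights; so is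
    that of g, which inherits the bound from f. *)
Lemma bracket_quotient_size d f e h e' n s g :
  let eps := bracket d f e h in
  eps != 0 -> bracket d f e' eps = 0 -> (e' + n = d + e)%N ->
  (0 < d)%N -> (s <= n)%N -> (s * (size f).-1 <= d)%N ->
  eps * g = f * h -> (s * (size g).-1 <= n)%N.
Proof.
move=> eps eps0 comm_eps En d0 sn sf E.
have [f0 h0] := bracket_neq0 eps0.
have g0 : g != 0.
  apply/eqP => g0; move/eqP: E.
  by rewrite g0 mulr0 eq_sym mulf_eq0 (negbTE f0) (negbTE h0).
have E1 := bracket0_size f0 eps0 comm_eps.
have E2 : ((size eps).-1 + (size g).-1 = (size f).-1 + (size h).-1)%N.
  have := congr1 (fun x : {poly K} => size x) E; rewrite !size_mul //.
  move: (size_poly_gt0 f) (size_poly_gt0 h) (size_poly_gt0 eps) (size_poly_gt0 g).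
  rewrite f0 h0 eps0 g0.
  move: (size f) (size h) (size eps) (size g) => a b c c' /=; lia.
have [E3|ne] := eqVneq (e * (size f).-1)%N (d * (size h).-1)%N; last first.
  have := bracket_size ne f0 h0; rewrite -/eps.
  move: (size_poly_gt0 eps); rewrite eps0; move: E2.
  move: (size f) (size h) (size eps) (size g) => a b c c' /=; nia.
rewrite -(leq_pmul2l d0).
have -> : (d * (s * (size g).-1) = n * (s * (size f).-1))%N.
  transitivity (s * (d * (size g).-1))%N; first by ring.
  have -> : (d * (size g).-1 = n * (size f).-1)%N by nia.
  by ring.
by rewrite [leqLHS]mulnC leq_mul2r sf orbT.
Qed.

End Bracket.

(** A nonconstant [a] has a root, also a root of [b]; cancelling this linear factor from both lowers
    the degree of [a]. *)
Lemma dvdp_mup (K : closedFieldType) (a b : {poly K}) : a != 0 -> b != 0 ->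
  (forall x, (mup x a <= mup x b)%N) -> a %| b.
Proof.
have [n] := ubnP (size a); elim: n a b => // n IHn a b lt a0 b0 le.
have [|] := boolP (size a == 1).
  by rewrite size_poly_eq1 => /eqp_dvdl ->; apply: dvd1p.
case/closed_rootP => x rx.
have mx : (0 < mup x a)%N by rewrite -XsubC_dvd // dvdp_XsubCl.
have /factor_theorem[a1 aE] := rx.
have : root b x by rewrite -dvdp_XsubCl XsubC_dvd //; apply: leq_trans mx (le x).
case/factor_theorem=> b1 bE.
have X0 : 'X - x%:P != 0 by rewrite polyXsubC_eq0.
have a10 : a1 != 0 by apply: contraNneq a0 => E; rewrite aE E mul0r.
have b10 : b1 != 0 by apply: contraNneq b0 => E; rewrite bE E mul0r.
rewrite aE bE dvdp_mul2r //; apply: IHn => // [|y].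
  by move: lt; rewrite aE size_Mmonic ?monicXsubC // size_XsubC addn2 /= ltnS.
by move: (le y); rewrite aE bE !mupM // leq_add2r.
Qed.

Lemma bracket_quotient (K : closedFieldType) d (f : {poly K}) e h e' n s :
  [pchar K] =i pred0 ->
  let eps := bracket d f e h in
  eps != 0 -> bracket d f e' eps = 0 -> (e' + n = d + e)%N ->
  (0 < d)%N -> (s <= n)%N -> (s * (size f).-1 <= d)%N ->
  exists g, [/\ eps * g = f * h, bracket d f n g = f & (s * (size g).-1 <= n)%N].
Proof.
move=> charK eps eps0 comm_eps En d0 sn sf.
have [f0 h0] := bracket_neq0 eps0.
have : eps %| f * h.
  apply: dvdp_mup => // [|x]; first by rewrite mulf_neq0.
  rewrite mupM //.
  have [k [/esym/eqP]] := bracket_root charK x d e' f0 eps0.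
  rewrite comm_eps mulr0 mulf_eq0 expf_eq0 polyXsubC_eq0 andbF /= => /eqP ->.
  rewrite horner0 eqxx => /esym/eqP E1.
  (* [E1] reads e' mup f = d mup eps. In the proportional case d mup eps <= (d + e) mup f = d (mup f
     + mup h); otherwise mup eps is exactly mup f + mup h - 1. *)
  have [E2|ne] := eqVneq (e * mup x f)%N (d * mup x h)%N; first by nia.
  have [k2 [E3]] := bracket_root charK x d e f0 h0.
  rewrite (negbTE ne) => k2x.
  have k20 : k2 != 0 by apply: contraFneq k2x => ->; rewrite horner0.
  have := congr1 (mup x) E3; rewrite !mupM // ?expf_neq0 ?polyXsubC_eq0 //.
  rewrite -/eps (@mup_XsubCX _ 1) mup_XsubCX eqxx (mupNroot (q := k2)) ?/root ?k2x //.
  by rewrite addn0 => <-; rewrite leq_addl.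
case/dvdpP=> g E; have {}E : eps * g = f * h by rewrite mulrC E.
exists g; split=> //.
  by move: E; apply: (bracket_quotient_eq eps0 comm_eps En).
by move: E; apply: (bracket_quotient_size charK eps0 comm_eps En).
Qed.

(** * Solutions of the equation {phi, g} = phi *)

Section Shape.
Variable K : fieldType.
Hypothesis charK : [pchar K] =i pred0.
Implicit Types phi g : {poly K}.

(** For n = r + s the polynomial [c *: 'X] is the form c x y, whose bracket acts diagonally on
    monomials. *)
Lemma coef_bracket_ZX d phi n c j :
  (bracket d phi n (c *: 'X))`_j = c * ((n * j)%:R - d%:R) * phi`_j.
Proof.
rewrite bracketZr coefZ /bracket derivX mulr1 [phi^`() * 'X]mulrC coefB !coefMn coef_mulX_deriv.
by rewrite -mulrnA -mulrA mulrBl !mulr_natl mulnC.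
Qed.

Lemma coef_bracket_bottom d phi n g b : (forall j, (j <= b)%N -> phi`_j = 0) ->
  (bracket d phi n g)`_b = phi`_b.+1 * g`_0 *+ (b.+1 * n).
Proof.
move=> low; rewrite /bracket coefB !coefMn [(phi * _)`_b]coefM big1 ?mul0rn ?subr0; last first.
  by move=> i _; rewrite low ?mul0r // -ltnS.
rewrite coefM (bigD1 ord_max) //= subnn big1 ?addr0 => [|i].
  by rewrite coef_deriv mulrnAl -mulrnA.
rewrite -val_eqE /= => nei; rewrite coef_deriv low ?mul0rn ?mul0r //.
by move: (ltn_ord i) nei; lia.
Qed.

(** The eigenvalues c (n j - d) are distinct for distinct j, and every monomial of phi must have
    eigenvalue 1. *)
Lemma bracket_ZX_monomial d phi n c i j : (0 < n)%N -> bracket d phi n (c *: 'X) = phi ->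
  phi`_i != 0 -> phi`_j != 0 -> i = j /\ (n * j != d)%N.
Proof.
move=> n0 E.
have E' k : phi`_k != 0 -> c * ((n * k)%:R - d%:R) = 1.
  move=> nz; apply: (mulIf nz); rewrite mul1r -[RHS](congr1 (fun x : {poly K} => x`_k) E).
  by rewrite coef_bracket_ZX.
move=> /E' Ei /E' Ej; split; last first.
  by apply/eqP => nj; move/eqP: Ej; rewrite nj subrr mulr0 eq_sym oner_eq0.
have c0 : c != 0 by apply/eqP => c0; move/eqP: Ei; rewrite c0 mul0r eq_sym oner_eq0.
have /(mulfI c0)/eqP := etrans Ei (esym Ej).
by rewrite subr_eq subrK natr_inj // eqn_pmul2l // => /eqP.
Qed.

Lemma poly_ZX g : (forall j, j != 1%N -> g`_j = 0) -> g = g`_1 *: 'X.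
Proof.
move=> g0; apply/polyP => j; rewrite coefZ coefX.
by case: (eqVneq j 1%N) => [->|/g0 ->]; rewrite ?mulr1 ?mulr0.
Qed.

Lemma coef_size_bound g s n j : (s * (size g).-1 <= n)%N -> g`_j != 0 -> (s * j <= n)%N.
Proof.
move=> sz nz; have lt : (j < size g)%N.
  by rewrite ltnNge; apply: contra nz => le; rewrite nth_default.
apply: leq_trans sz; rewrite leq_mul2l -ltnS prednK ?lt ?orbT //; exact: leq_ltn_trans lt.
Qed.

(** For b > 0 a constant term of g would give the bracket a term of degree b - 1, below the lowest
    term of phi. *)
Lemma bracket_bottom d phi n g b : (0 < n)%N -> bracket d phi n g = phi ->
  phi`_b != 0 -> (forall j, (j < b)%N -> phi`_j = 0) -> g`_0 != 0 -> b = 0%N.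
Proof.
move=> n0 E nzb low g0; have [//|b0] := posnP b.
have low' j : (j <= b.-1)%N -> phi`_j = 0 by move=> le; apply: low; lia.
have := coef_bracket_bottom d n g low'; rewrite E low' // prednK // => /esym/eqP.
rewrite -mulr_natr !mulf_eq0 (negbTE nzb) (negbTE g0) natr_eq0 //= muln_eq0; lia.
Qed.

(** A g of degree m + 1 >= 2 would raise the top degree from b to b + m, so the coefficient there
    has to vanish. *)
Lemma bracket_top d phi n g b m : bracket d phi n g = phi -> (0 < m)%N ->
  phi`_b != 0 -> (size phi <= b.+1)%N -> g`_m.+1 != 0 -> (size g <= m.+2)%N ->
  (n * b = d * m.+1)%N.
Proof.
move=> E m0 nzb sphi nzg sg; have := coef_bracket_top d n sphi sg.
rewrite E coefXM addnS /= nth_default; last by apply: leq_trans sphi _; lia.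
move/esym/eqP; rewrite !mulf_eq0 (negbTE nzb) (negbTE nzg) /= subr_eq0 natr_inj //.
by move/eqP.
Qed.

(** The conditions on phi say that y and x divide the form. The first excludes an x^2 term of g by
    [bracket_bottom], the second a y^2 term by [bracket_top]; hence g = c x y. *)
Lemma shape_diagonal d phi g b : bracket d phi 2 g = phi -> ((size g).-1 <= 2)%N ->
  phi`_0 = 0 -> (size phi <= d)%N -> phi`_b != 0 ->
  phi = phi`_b *: 'X^b /\ (2 * b != d)%N.
Proof.
move=> E sg low sphi nzb.
have exb : exists b, phi`_b != 0 by exists b.
have phi0 : phi != 0 by apply: contraNneq nzb => ->; rewrite coef0.
have [c nzc cmin] := ex_minnP exb.
have g0 : g`_0 = 0.
  apply/eqP/negPn/negP => g0; have c0 : c = 0%N.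
    apply: (bracket_bottom _ E nzc _ g0) => // j lt.
    by apply/eqP/negPn/negP => /cmin; lia.
  by rewrite c0 low eqxx in nzc.
have g2 : g`_2 = 0.
  apply/eqP/negPn/negP => g2.
  have nzt : phi`_(size phi).-1 != 0 by rewrite -lead_coefE lead_coef_eq0.
  have := bracket_top E (m := 1) isT nzt _ g2.
  rewrite prednK ?size_poly_gt0 // => /(_ (leqnn _)).
  move: sphi (size_poly_gt0 phi) sg; rewrite phi0; move: (size phi) (size g) => x y.
  by move=> le gt le' H; have := H ltac:(lia); lia.
have gE : g = g`_1 *: 'X.
  apply: poly_ZX => -[|[|[|j]]] // _; apply/eqP/negPn/negP => nz.
  by have := @coef_size_bound g 1 2 j.+3; rewrite !mul1n => /(_ sg nz).
rewrite gE in E.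
have mono j : phi`_j != 0 -> b = j /\ (2 * j != d)%N.
  by move=> nzj; apply: (bracket_ZX_monomial _ E nzb nzj).
split; last by case: (mono b nzb).
apply/polyP => j; rewrite coefZ coefXn; case: (eqVneq j b) => [->|ne]; first by rewrite mulr1.
by rewrite mulr0; apply/eqP/negPn/negP => /mono[E' _]; rewrite E' eqxx in ne.
Qed.

(** Since r < s, g has degree at most 1. Without constant term it would be c x y and phi a monomial,
    against the two nonzero coefficients. A constant term forces b = 0, and its residue gives r | s,
    so r = 1. *)
Lemma shape_steep d phi g r s b j : coprime r s -> (0 < r < s)%N ->
  bracket d phi (r + s) g = phi -> (s * (size g).-1 <= r + s)%N ->
  (forall j, g`_j != 0 -> s * j = s %[mod r]) ->
  phi`_b != 0 -> phi`_j != 0 -> (b < j)%N -> (forall j, (j < b)%N -> phi`_j = 0) ->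
  b = 0%N /\ r = 1%N.
Proof.
move=> cop /andP[r0 rs] E sg res nzb nzj bj low.
have [g0|g0] := eqVneq g`_0 0; last first.
  split; first by apply: (bracket_bottom _ E nzb low g0); lia.
  have := res 0%N g0; rewrite muln0 mod0n => /esym/eqP; rewrite -/(dvdn r s) => /gcdn_idPl E'.
  by move: cop; rewrite /coprime E' => /eqP.
have gE : g = g`_1 *: 'X.
  apply: poly_ZX => -[|[|i]] // _; apply/eqP/negPn/negP => /(coef_size_bound sg); nia.
rewrite gE in E.
have [] := bracket_ZX_monomial _ E nzb nzj; lia.
Qed.

(** Residues and weight leave only x y and, for s = 1, y^(r+1) in g. The form c x y alone would make
    phi a monomial, so y^(r+1) occurs and [bracket_top] applies. *)
Lemma shape_shallow d phi g r s b j : coprime r s -> (0 < s < r)%N ->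
  bracket d phi (r + s) g = phi -> (s * (size g).-1 <= r + s)%N ->
  (forall j, g`_j != 0 -> s * j = s %[mod r]) ->
  phi`_b != 0 -> phi`_j != 0 -> (j < b)%N -> (size phi <= b.+1)%N ->
  b = d.
Proof.
move=> cop /andP[s0 sr] E sg res nzb nzj jb sphi.
have supp i : g`_i != 0 -> i = 1%N \/ i = r.+1 /\ s = 1%N.
  move=> nz; have le := coef_size_bound sg nz.
  have /eqP := res i nz; case: i nz le => [|i] nz le.
    rewrite muln0 mod0n eq_sym -/(dvdn r s) => /dvdn_leq; lia.
  rewrite mulnS -[X in _ == X %[mod r]]addn0 eqn_modDl mod0n -/(dvdn r (s * i)) Gauss_dvdr // => /dvdnP[k Ei].
  case: k Ei => [|k] Ei; first by left; rewrite Ei.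
  right; have : (s * k.+1 <= 1)%N.
    rewrite -(leq_pmul2r (_ : 0 < r)%N); last lia.
    by rewrite Ei in le; nia.
  by rewrite Ei; nia.
have [gr|gr] := eqVneq g`_r.+1 0.
  have gE : g = g`_1 *: 'X.
    apply: poly_ZX => i ne; apply/eqP/negPn/negP => nz.
    by have [E'|[E' _]] := supp i nz; [rewrite E' eqxx in ne | rewrite E' gr eqxx in nz].
  rewrite gE in E; have [] := bracket_ZX_monomial _ E nzb nzj; lia.
have [|[_ s1]] := supp _ gr; first lia.
have := bracket_top E (m := r) _ nzb sphi gr.
rewrite s1 addn1 => H; have {}H : (r.+1 * b = d * r.+1)%N.
  by apply: H; [lia | move: sg; rewrite s1; lia].
by nia.
Qed.

End Shape.

(** * Edges of the Newton polygon *)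

(** The edge leaving (a, b) to the right ends at a point with i > a that maximises (i - a) / (b -
    j). Such points lie strictly below the diagonal through (a, b), so b - j > i - a > 0; hence no
    subtraction is truncated and s < r. *)
Lemma newton_edge (S : nat -> nat -> Prop) a b i0 j0 :
  (forall i j, S i j -> (i + j <= a + b)%N) ->
  (forall i j, S i j -> (i + j = a + b)%N -> i = a) ->
  S i0 j0 -> (a < i0)%N ->
  exists r s i j, [/\ coprime r s, (0 < s < r)%N, S i j, (a < i)%N /\
    (r * i + s * j = r * a + s * b)%N &
    forall i' j', S i' j' -> (r * i' + s * j' <= r * a + s * b)%N /\
      ((r * i' + s * j' = r * a + s * b)%N -> (j' <= b)%N)].
Proof.
move=> tot top S0 a0.
pose N := (a + b).+1.
pose P (x : 'I_N * 'I_N) := `[< S x.1 x.2 >] && (a < x.1)%N.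
pose F (x : 'I_N * 'I_N) : rat := (x.1 - a)%:R / (b - x.2)%:R.
have ltN i j : S i j -> (i < N)%N /\ (j < N)%N by move/tot; rewrite /N; lia.
have below i j : S i j -> (a < i)%N -> (i - a < b - j)%N.
  move=> Sij lt; have := tot _ _ Sij; have := top _ _ Sij; lia.
have [lti0 ltj0] := ltN _ _ S0.
have P0 : P (Ordinal lti0, Ordinal ltj0) by apply/andP; split=> //; apply/asboolP.
have [[i j] /andP[/= /asboolP Sij ai] maxF] := Order.TotalTheory.arg_maxP F P0.
have gap := below _ _ Sij ai.
have cross i' j' : S i' j' -> (a < i')%N -> ((i' - a) * (b - j) <= (i - a) * (b - j'))%N.
  move=> S' lt'; have [lti' ltj'] := ltN _ _ S'.
  have gap' := below _ _ S' lt'.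
  have := maxF (Ordinal lti', Ordinal ltj'); rewrite /P /F /= lt' andbT asboolT // => /(_ isT).
  rewrite Num.Theory.ler_pdivrMr ?Num.Theory.ltr0n; last lia.
  rewrite mulrAC Num.Theory.ler_pdivlMr ?Num.Theory.ltr0n; last lia.
  by rewrite -!natrM Num.Theory.ler_nat.
(* The weight (r, s) is the primitive normal vector of the edge. *)
pose G := gcdn (b - j) (i - a).
have G0 : (0 < G)%N by rewrite gcdn_gt0; lia.
have [r rE] : exists r, (b - j = r * G)%N by exists ((b - j) %/ G)%N; rewrite divnK ?dvdn_gcdl.
have [s sE] : exists s, (i - a = s * G)%N by exists ((i - a) %/ G)%N; rewrite divnK ?dvdn_gcdr.
exists r, s, (i : nat), (j : nat).
have cop : coprime r s.
  by rewrite /coprime -(eqn_pmul2r G0) mul1n muln_gcdl -rE -sE.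
have s0 : (0 < s)%N by nia.
have rs : (s < r)%N by nia.
split=> //; [by rewrite s0 | by split=> //; nia |].
move=> i' j' S'; have t' := tot _ _ S'; have u' := top _ _ S'.
have [le|lt] := leqP i' a; first by split; nia.
have c' := cross _ _ S' lt; have b' := below _ _ S' lt.
split; last by nia.
have : ((i' - a) * r <= s * (b - j'))%N.
  by rewrite -(leq_pmul2r G0); move: c'; rewrite rE sE; nia.
nia.
Qed.

(* Stated for an abstract algebra so that unification never unfolds the quotient
   that defines weyl K. *)
Record weyl_axioms (K : fieldType) (A : algType K) (p q : A) : Prop := WeylAxioms {
  weyl_axiom_comm : q * p - p * q = 1;
  weyl_axiom_ind : forall P : A -> Prop,
    P 1 -> (forall u v, P u -> P v -> P (u + v)) ->
    (forall c u, P u -> P (c *: u)) ->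
    (forall u, P u -> P (p * u)) -> (forall u, P u -> P (q * u)) ->
    forall u, P u;
  weyl_axiom_free : forall m n (a : nat -> nat -> K),
    \sum_(i < m) \sum_(j < n) a i j *: (p ^+ i * q ^+ j) = 0 ->
    forall i j, (i < m)%N -> (j < n)%N -> a i j = 0;
  weyl_axiom_hom : forall z w : A, z * w - w * z = 1 ->
    exists f : {lrmorphism A -> A}, f q = z /\ f p = w
}.

Lemma weyl_axioms_weyl (K : fieldType) : [pchar K] =i pred0 ->
  weyl_axioms (weyl_p K) (weyl_q K).
Proof.
move=> charK; split.
- exact: weyl_comm_qp.
- exact: weyl_ind.
- by move=> m n a; apply: weyl_sum_free.
- exact: weyl_hom_exists.
Qed.

(** * Coefficients in the monomial basis *)

Section WeylCoef.
Variables (K : fieldType) (A : algType K) (p q : A).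

Definition wmon (i j : nat) : A := p ^+ i * q ^+ j.

(** Asking for the sum at every size N >= B lets two expansions be compared at a common size. *)
Definition expansion (u : A) (a : nat -> nat -> K) : Prop :=
  exists B, (forall i j, (B <= i)%N || (B <= j)%N -> a i j = 0) /\
    (forall N, (B <= N)%N -> u = \sum_(i < N) \sum_(j < N) a i j *: wmon i j).

Section Expansion.
Hypothesis wA : weyl_axioms p q.

Lemma mulp_wmon i j : p * wmon i j = wmon i.+1 j.
Proof. by rewrite /wmon mulrA -exprS. Qed.

Lemma mulq_wmon i j : q * wmon i j = wmon i j.+1 + wmon i.-1 j *+ i.
Proof.
by rewrite /wmon mulrA (mulqpX (weyl_axiom_comm wA)) mulrDl -mulrA -exprS mulrnAl.
Qed.

Lemma wmonM i j k l : wmon i j * wmon k l =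
  \sum_(t < j.+1) wmon (i + (k - t)) (j - t + l) *+ ('C(j, t) * k ^_ t).
Proof.
rewrite /wmon mulrA -(mulrA _ (q ^+ j)) (mulqXpX (weyl_axiom_comm wA)).
rewrite mulr_sumr mulr_suml; apply: eq_bigr => t _.
by rewrite mulrnAr mulrnAl !mulrA -exprD -mulrA -exprD.
Qed.

Lemma wmon_ind (P : A -> Prop) :
  P 0 -> (forall c i j u, P u -> P (c *: wmon i j + u)) -> forall u, P u.
Proof.
move=> P0 PS u.
suff [s ->] : exists s : seq (K * (nat * nat)),
    u = \sum_(x <- s) x.1 *: wmon x.2.1 x.2.2.
  by elim: s => [|x s IHs]; rewrite ?big_nil // big_cons; apply: PS.
elim/(weyl_axiom_ind wA): u => [|u v [s ->] [t ->]|c u [s ->]|u [s ->]|u [s ->]].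
- by exists [:: (1, (0, 0)%N)]; rewrite big_seq1 scale1r /wmon mulr1.
- by exists (s ++ t); rewrite big_cat.
- exists [seq (c * x.1, x.2) | x <- s]; rewrite big_map scaler_sumr.
  by apply: eq_bigr => x _; rewrite scalerA.
- exists [seq (x.1, (x.2.1.+1, x.2.2)) | x <- s]; rewrite big_map mulr_sumr.
  by apply: eq_bigr => x _; rewrite -scalerAr mulp_wmon.
exists ([seq (x.1, (x.2.1, x.2.2.+1)) | x <- s] ++
        [seq (x.1 *+ x.2.1, (x.2.1.-1, x.2.2)) | x <- s]).
rewrite big_cat !big_map mulr_sumr /= -big_split; apply: eq_bigr => x _ /=.
by rewrite -scalerAr mulq_wmon scalerDr -scalerMnl scalerMnr.
Qed.

Lemma expansionD c u v a b : expansion u a -> expansion v b ->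
  expansion (c *: u + v) (fun i j => c * a i j + b i j).
Proof.
move=> [B [a0 ua]] [C [b0 vb]]; exists (maxn B C); split=> [i j ij|N leN].
  by rewrite a0 ?b0 ?mulr0 ?addr0 //; lia.
rewrite {1}(ua N) ?{1}(vb N); try lia.
rewrite scaler_sumr -big_split; apply: eq_bigr => i _ /=.
rewrite scaler_sumr -big_split; apply: eq_bigr => j _ /=.
by rewrite scalerA scalerDl.
Qed.

Lemma expansion_wmon k l :
  expansion (wmon k l) (fun i j => ((i == k) && (j == l))%:R).
Proof.
exists (maxn k l).+1; split=> [i j ij|N leN].
  by rewrite (_ : _ && _ = false) //; apply/negbTE/negP; lia.
have [ltk ltl] : (k < N)%N /\ (l < N)%N by lia.
rewrite (bigD1 (Ordinal ltk)) //= (bigD1 (Ordinal ltl)) //= !eqxx.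
rewrite scale1r !big1 ?addr0 // => [i|j].
  by move=> /negbTE nek; rewrite big1 // => j _; rewrite -val_eqE /= in nek; rewrite nek scale0r.
by rewrite -val_eqE /= => /negbTE ->; rewrite scale0r.
Qed.

Lemma expansion0 : expansion 0 (fun _ _ => 0).
Proof.
exists 0%N; split=> // N _; rewrite big1 // => i _.
by rewrite big1 // => j _; rewrite scale0r.
Qed.

Lemma expansion_exists u : exists a, expansion u a.
Proof.
elim/(wmon_ind): u => [|c i j u [a ua]]; first by exists (fun _ _ => 0); apply: expansion0.
by eexists; apply: expansionD ua; apply: expansion_wmon.
Qed.

Lemma expansion_uniq u a b :
  expansion u a -> expansion u b -> forall i j, a i j = b i j.
Proof.
move=> ua ub i j.
have [B [d0 /(_ (maxn B (maxn i j).+1))]] := expansionD (-1) ua ub.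
rewrite leq_maxl scaleN1r addNr => /(_ isT)/esym E0.
have := weyl_axiom_free wA (a := fun i j => -1 * a i j + b i j) E0 (i := i) (j := j).
move=> /(_ ltac:(lia) ltac:(lia)).
by rewrite mulN1r addrC => /eqP; rewrite subr_eq0 => /eqP.
Qed.

End Expansion.

(* The case distinction makes wcoef i j linear without a hypothesis on p and q, so
   that the canonical structure below is usable; the junk value 0 is never reached. *)
Definition wcoef (i j : nat) (u : A) : K :=
  if pselect (weyl_axioms p q) is left wA then
    projT1 (cid (expansion_exists wA u)) i j
  else 0.

Lemma wcoef_is_linear i j : scalar (wcoef i j).
Proof.
rewrite /wcoef; case: pselect => [wA c u v|_ c u v]; last by rewrite mulr0 addr0.
have coefE x : expansion x (projT1 (cid (expansion_exists wA x))) by case: cid.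
exact: (expansion_uniq wA (coefE _) (expansionD c (coefE u) (coefE v))) i j.
Qed.

HB.instance Definition _ i j :=
  GRing.isLinear.Build K A K *%R (wcoef i j) (wcoef_is_linear i j).

Hypothesis wA : weyl_axioms p q.

Lemma wcoefP u : expansion u (fun i j => wcoef i j u).
Proof. by rewrite /wcoef; case: pselect => // wA'; case: cid. Qed.

Lemma wcoef_expansion u a i j : expansion u a -> wcoef i j u = a i j.
Proof. by move=> ua; apply: (expansion_uniq wA (wcoefP u) ua). Qed.

Lemma wcoef_wmon i j k l : wcoef i j (wmon k l) = ((i == k) && (j == l))%:R.
Proof. exact: (wcoef_expansion _ _ (expansion_wmon k l)). Qed.

Lemma wcoef_bound u : exists B, (forall i j, (B <= i)%N || (B <= j)%N -> wcoef i j u = 0) /\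
  u = \sum_(i < B) \sum_(j < B) wcoef i j u *: wmon i j.
Proof. by have [B [u0 uE]] := wcoefP u; exists B; split=> //; apply: uE. Qed.

Lemma wcoef_eq0 u : (forall i j, wcoef i j u = 0) -> u = 0.
Proof.
move=> u0; have [B [_ ->]] := wcoef_bound u.
by rewrite big1 // => i _; rewrite big1 // => j _; rewrite u0 scale0r.
Qed.

Lemma wcoef_nz u : u != 0 -> exists i j, wcoef i j u != 0.
Proof.
move=> u0; apply: contrapT => H; case/negP: u0; apply/eqP/wcoef_eq0 => i j.
by apply/eqP/negPn/negP => nz; case: H; exists i, j.
Qed.

Lemma wcoef_box u m n :
  (forall i j, wcoef i j u != 0 -> (i <= m)%N && (j <= n)%N) ->
  u = \sum_(i < m.+1) \sum_(j < n.+1) wcoef i j u *: wmon i j.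
Proof.
move=> sub; have [B [u0 uE]] := wcoefP u.
rewrite {1}(uE (maxn B (maxn m n).+1)) ?leq_maxl //.
set N := maxn _ _.
have wid (d : nat) (G : nat -> A) : (d <= N)%N -> (forall i, (d <= i)%N -> G i = 0) ->
    \sum_(i < N) G i = \sum_(i < d) G i.
  move=> leN G0; rewrite -!(big_mkord xpredT G) (big_cat_nat (n := d)) //=.
  by rewrite [X in _ + X]big_nat_cond [X in _ + X]big1 ?addr0 // => i; rewrite andbT => /andP[/G0].
rewrite (wid m.+1 (fun i => \sum_(j < N) wcoef i j u *: wmon i j)); try lia.
  apply: eq_bigr => i _; apply: (wid n.+1 (fun j => wcoef i j u *: wmon i j)); first lia.
  move=> j ltj; case: (eqVneq (wcoef i j u) 0) => [->|/sub]; last lia.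
  by rewrite scale0r.
move=> i lti; rewrite big1 // => j _.
case: (eqVneq (wcoef i j u) 0) => [->|/sub]; last lia.
by rewrite scale0r.
Qed.

Lemma wcoef_weyl_sum m n (a : nat -> nat -> K) i j : (i < m)%N -> (j < n)%N ->
  wcoef i j (\sum_(i < m) \sum_(j < n) a i j *: wmon i j) = a i j.
Proof.
move=> lti ltj; rewrite linear_sum (bigD1 (Ordinal lti)) //=.
rewrite linear_sum (bigD1 (Ordinal ltj)) //= linearZ /= wcoef_wmon !eqxx mulr1.
rewrite !big1 ?addr0 // => [k /negbTE nek|l /negbTE nel].
  rewrite -val_eqE /= eq_sym in nek.
  by rewrite linear_sum big1 // => l _; rewrite linearZ /= wcoef_wmon nek mulr0.
by rewrite -val_eqE /= eq_sym in nel; rewrite linearZ /= wcoef_wmon nel andbF mulr0.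
Qed.

Lemma wcoef_weyl_sum_out m n (a : nat -> nat -> K) i j : (m <= i)%N || (n <= j)%N ->
  wcoef i j (\sum_(i < m) \sum_(j < n) a i j *: wmon i j) = 0.
Proof.
move=> out; rewrite linear_sum big1 // => k _ /=.
rewrite linear_sum big1 // => l _ /=; rewrite linearZ /= wcoef_wmon.
rewrite (_ : _ && _ = false) ?mulr0 //.
by apply/negP => /andP[/eqP ik /eqP jl]; move: out (ltn_ord k) (ltn_ord l); lia.
Qed.

End WeylCoef.

(** * Weighted filtrations and leading forms *)

Section Weights.
Variables (K : fieldType) (A : algType K) (p q : A) (r s : nat).
Local Notation wcoef := (wcoef p q).
Local Notation wmon := (wmon p q).

(* Here p has weight r and q has weight s.  As r > 0, at most one i contributes to
   each coefficient of lead d u, which is the degree d form of u at x = 1. *)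
Definition fil (d : nat) (u : A) : Prop :=
  forall i j, wcoef i j u != 0 -> (r * i + s * j <= d)%N.

Definition lead (d : nat) (u : A) : {poly K} :=
  \poly_(j < d.+1) \sum_(i < d.+1 | (r * i + s * j == d)%N) wcoef i j u.

Lemma lead_is_linear d : linear (lead d).
Proof.
move=> c u v; apply/polyP => j; rewrite coefD coefZ !coef_poly.
case: ifP => _; last by rewrite mulr0 addr0.
rewrite mulr_sumr -big_split; apply: eq_bigr => i _ /=.
by rewrite linearP.
Qed.

HB.instance Definition _ d :=
  GRing.isLinear.Build K A {poly K} _ (lead d) (lead_is_linear d).

Lemma fil0 d : fil d 0.
Proof. by move=> i j; rewrite linear0 eqxx. Qed.

Lemma filP d c u v : fil d u -> fil d v -> fil d (c *: u + v).
Proof.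
move=> fu fv i j; rewrite linearP /=.
have [->|/fu //] := eqVneq (wcoef i j u) 0; rewrite mulr0 add0r; exact: fv.
Qed.

Lemma filD d u v : fil d u -> fil d v -> fil d (u + v).
Proof. by move=> fu fv; rewrite -[u]scale1r; apply: filP. Qed.

Lemma filZ d c u : fil d u -> fil d (c *: u).
Proof. by move=> fu; rewrite -[c *: u]addr0; apply: filP => //; apply: fil0. Qed.

Lemma filN d u : fil d u -> fil d (- u).
Proof. by rewrite -scaleN1r; apply: filZ. Qed.

Lemma filMn d u n : fil d u -> fil d (u *+ n).
Proof. by rewrite -scaler_nat; apply: filZ. Qed.

Lemma fil_sum d (I : Type) (t : seq I) (P : pred I) (G : I -> A) :
  (forall i, P i -> fil d (G i)) -> fil d (\sum_(i <- t | P i) G i).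
Proof. by move=> fG; elim/big_ind: _ => //; [apply: fil0 | apply: filD]. Qed.

Lemma fil_le d e u : (d <= e)%N -> fil d u -> fil e u.
Proof. by move=> le fu i j /fu; move/leq_trans; apply. Qed.

Hypotheses (r0 : (0 < r)%N) (s0 : (0 < s)%N).

Lemma coef_lead d u i j : (r * i + s * j)%N = d -> (lead d u)`_j = wcoef i j u.
Proof.
move=> E; have [ltj lti] : (j < d.+1)%N /\ (i < d.+1)%N by split; nia.
rewrite coef_poly ltj (bigD1 (Ordinal lti)) /= ?E ?eqxx // big1 ?addr0 // => k.
case/andP=> /eqP Ek; rewrite -val_eqE /= => /eqP []; nia.
Qed.

Lemma lead_coefP d u j : (lead d u)`_j != 0 ->
  exists2 i, (r * i + s * j)%N = d & wcoef i j u != 0.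
Proof.
rewrite coef_poly; case: ifP => _; last by rewrite eqxx.
move=> nz; apply: contrapT => H; case/negP: nz; apply/eqP; apply: big1 => i /eqP E.
by apply/eqP/negPn/negP => nz; case: H; exists i.
Qed.

Lemma lead_size d u j : (lead d u)`_j != 0 -> (s * j <= d)%N.
Proof. by case/lead_coefP=> i <- _; rewrite leq_addl. Qed.

Lemma fil_lead0 d e u : fil d u -> (d < e)%N -> lead e u = 0.
Proof.
move=> fu lt; apply/polyP => j; rewrite coef0; apply/eqP/negPn/negP.
by case/lead_coefP => i E /fu; rewrite E leqNgt lt.
Qed.

Hypothesis wA : weyl_axioms p q.
Local Notation comm u v := (u * v - v * u).

Lemma lead_wmon d k l :
  lead d (wmon k l) = if (r * k + s * l == d)%N then 'X^l else 0.
Proof.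
apply/polyP => j; have [E|nE] := eqVneq.
  rewrite coefXn; have [->|ne] := eqVneq j l.
    by rewrite (coef_lead _ E) (wcoef_wmon wA) !eqxx.
  apply/eqP/negPn/negP => /lead_coefP[i _].
  by rewrite (wcoef_wmon wA) (negbTE ne) andbF eqxx.
rewrite coef0; apply/eqP/negPn/negP => /lead_coefP[i E].
rewrite (wcoef_wmon wA); case: (eqVneq i k) => [ik|]; last by rewrite eqxx.
case: (eqVneq j l) => [jl|]; last by rewrite eqxx.
by case/eqP: nE; rewrite -E ik jl.
Qed.

Lemma fil_wmon d k l : (r * k + s * l <= d)%N -> fil d (wmon k l).
Proof.
move=> le i j; rewrite (wcoef_wmon wA).
by case: (eqVneq i k) => [->|]; case: (eqVneq j l) => [->|]; rewrite ?eqxx.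
Qed.

Lemma fil_ind d (P : A -> Prop) :
  P 0 -> (forall c u v, P u -> P v -> P (c *: u + v)) ->
  (forall i j, (r * i + s * j <= d)%N -> P (wmon i j)) ->
  forall u, fil d u -> P u.
Proof.
move=> P0 PL Pm u fu.
have PD v w : P v -> P w -> P (v + w) by move=> Pv Pw; rewrite -[v]scale1r; apply: PL.
have [B [_ ->]] := wcoef_bound wA u.
elim/big_ind: _ => // i _; elim/big_ind: _ => // j _.
have [->|/fu/Pm Pij] := eqVneq (wcoef i j u) 0; first by rewrite scale0r.
by rewrite -[_ *: _]addr0; apply: PL.
Qed.

Lemma fil_exists u : exists d, fil d u.
Proof.
have [B [u0 _]] := wcoef_bound wA u; exists (r * B + s * B)%N => i j nz.
have [lti|le] := ltnP i B; last by rewrite u0 ?eqxx ?le in nz.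
have [ltj|le] := ltnP j B; first by nia.
by rewrite u0 ?eqxx ?le ?orbT in nz.
Qed.

Lemma fil_lead_exists u : u != 0 -> exists d, fil d u /\ lead d u != 0.
Proof.
move=> /(wcoef_nz wA)[i0 [j0 nz0]]; have [D fu] := fil_exists u.
pose Q d := `[< exists i j, (r * i + s * j)%N = d /\ wcoef i j u != 0 >].
have exQ : exists d, Q d by exists (r * i0 + s * j0)%N; apply/asboolP; exists i0, j0.
have bQ d : Q d -> (d <= D)%N by case/asboolP=> i [j [<- /fu]].
have [d /asboolP[i [j [E nz]]] dmax] := ex_maxnP exQ bQ.
exists d; split=> [k l nzk|]; first by apply: dmax; apply/asboolP; exists k, l.
by apply: contraNneq nz => l0; rewrite -(coef_lead u E) l0 coef0.
Qed.

Lemma wmonM_rem i j k l : wmon i j * wmon k l - wmon (i + k) (j + l) =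
  \sum_(t < j) wmon (i + (k - t.+1)) (j - t.+1 + l) *+ ('C(j, t.+1) * k ^_ t.+1).
Proof. by rewrite (wmonM wA) big_ord_recl !subn0 bin0 ffactn0 mulr1n addrAC subrr add0r. Qed.

Lemma fil_wmonM_rem n i j k l :
  (r * (i + k) + s * (j + l) <= n + (r + s))%N ->
  fil n (wmon i j * wmon k l - wmon (i + k) (j + l)).
Proof.
move=> le; rewrite wmonM_rem; apply: fil_sum => -[t /= lt_tj] _.
have [lt_tk|le_kt] := ltnP t k; last by rewrite ffact_small ?muln0 ?mulr0n //; apply: fil0.
by apply: filMn; apply: fil_wmon; nia.
Qed.

(** Each reordering step removes one p and one q, of weight r + s together. At weight exactly r + s
    below the product only the first correction, with factor j k, survives. *)
Lemma lead_wmonM_rem n i j k l :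
  (r * (i + k) + s * (j + l) <= n + (r + s))%N ->
  lead n (wmon i j * wmon k l - wmon (i + k) (j + l)) =
  if (r * (i + k) + s * (j + l) == n + (r + s))%N then (j * k)%:R *: 'X^((j + l).-1) else 0.
Proof.
move=> le; rewrite wmonM_rem.
case: j le => [|j] le; first by rewrite big_ord0 linear0 mul0n scale0r if_same.
rewrite big_ord_recl linearD linear_sum big1 ?addr0 => /= [|t _].
  case: k le => [|k] le; first by rewrite ffactn1 !muln0 mulr0n linear0 scale0r if_same.
  rewrite linearMn /= lead_wmon bin1 ffactn1 scaler_nat.
  rewrite !subn1 addSn /= (_ : (_ == n) = (r * (i + k.+1) + s * (j.+1 + l) == n + (r + s))%N).
    by case: ifP; rewrite ?mul0rn.
  by apply/eqP/eqP; nia.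
have [lt_tk|le_kt] := ltnP t.+1 k; last first.
  by rewrite ffact_small ?muln0 ?mulr0n ?linear0.
rewrite linearMn /= lead_wmon (_ : (_ == n) = false) ?mul0rn //.
by apply/negbTE/eqP; rewrite /bump /= => E; move: (ltn_ord t) le E; nia.
Qed.

(** By bilinearity it suffices to treat monomials, where reordering only adds terms of smaller
    weight. *)
Lemma mul_fil_lead d e u v : fil d u -> fil e v ->
  fil (d + e) (u * v) /\ lead (d + e) (u * v) = lead d u * lead e v.
Proof.
move=> fu fv; move: u fu; apply: fil_ind => [|c u u' [f1 l1] [f2 l2]|i j leij].
- by rewrite mul0r !linear0 mul0r; split=> //; apply: fil0.
- rewrite mulrDl -scalerAl !linearP /= l1 l2 mulrDl -scalerAl; split=> //.
  exact: filP.
move: v fv; apply: fil_ind => [|c v v' [f1 l1] [f2 l2]|k l lekl].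
- by rewrite mulr0 !linear0 mulr0; split=> //; apply: fil0.
- rewrite mulrDr -scalerAr !linearP /= l1 l2 mulrDr -scalerAr; split=> //.
  exact: filP.
have le : (r * (i + k) + s * (j + l) <= d + e)%N by nia.
have le' : (r * (i + k) + s * (j + l) <= d + e + (r + s))%N by nia.
rewrite -(subrK (wmon (i + k) (j + l)) (wmon i j * _)); split.
  by apply: filD; [apply: fil_wmonM_rem | apply: fil_wmon].
rewrite linearD /= lead_wmonM_rem // (_ : (_ == _) = false) ?add0r; last nia.
rewrite !lead_wmon.
have -> : (r * (i + k) + s * (j + l) == d + e)%N =
    (r * i + s * j == d)%N && (r * k + s * l == e)%N.
  by apply/eqP/andP => [E|[/eqP E1 /eqP E2]]; [split; apply/eqP; nia | nia].
by do 2!case: (_ == _); rewrite /= ?mul0r ?mulr0 ?exprD.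
Qed.

Lemma fil_lead_expr e x n : fil e x ->
  fil (e * n) (x ^+ n) /\ lead (e * n) (x ^+ n) = lead e x ^+ n.
Proof.
move=> fx; elim: n => [|n [IHf IHl]]; last first.
  by rewrite !exprS mulnS -IHl; apply: mul_fil_lead.
rewrite !expr0 muln0; have -> : 1 = wmon 0 0 by rewrite /wmon mulr1.
rewrite lead_wmon // !muln0 eqxx expr0; split=> //.
by apply: fil_wmon => //; lia.
Qed.

(** On monomials the ordered products cancel and the first corrections leave the factor j k - i l.
    For d = r i + s j and e = r k + s l one has j e - l d = r (j k - i l), which explains the scalar
    [r%:R]. *)
Lemma fil_lead_comm d e n u v :
  (d + e <= n + (r + s))%N -> fil d u -> fil e v ->
  fil n (comm u v) /\
  ((d + e)%N = (n + (r + s))%N ->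
   r%:R *: lead n (comm u v) =
   bracket d (lead d u) e (lead e v)).
Proof.
rewrite /bracket => le fu fv; move: u fu; apply: fil_ind => [|c u u' [f1 l1] [f2 l2]|i j leij].
- rewrite mul0r mulr0 subrr !linear0 !mul0r !mul0rn subrr; split; first exact: fil0.
  by rewrite ?scaler0 ?linear0.
- have -> : comm (c *: u + u') v = c *: comm u v + comm u' v.
    by rewrite mulrDl mulrDr -scalerAl -scalerAr scalerBr opprD addrACA.
  split=> [|E]; first exact: filP.
  rewrite [lead n _]linearP [lead d _]linearP /= scalerDr scalerA mulrC -scalerA l1 // l2 // derivD derivZ.
  rewrite !mulrDl !mulrnDl -!scalerAl scalerBr !scalerMnr.
  by rewrite opprD addrACA.
move: v fv; apply: fil_ind => [|c v v' [f1 l1] [f2 l2]|k l lekl].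
- rewrite mul0r mulr0 subrr !linear0 !mulr0 !mul0rn subrr; split; first exact: fil0.
  by rewrite ?scaler0 ?linear0.
- set u := wmon i j in f1 f2 l1 l2 *.
  have -> : comm u (c *: v + v') = c *: comm u v + comm u v'.
    by rewrite mulrDl mulrDr -scalerAl -scalerAr scalerBr opprD addrACA.
  split=> [|E]; first exact: filP.
  rewrite [lead n _]linearP [lead e _]linearP /= scalerDr scalerA mulrC -scalerA l1 // l2 // derivD derivZ.
  rewrite !mulrDr !mulrnDl -!scalerAr scalerBr !scalerMnr.
  by rewrite opprD addrACA.
have -> : comm (wmon i j) (wmon k l) =
    (wmon i j * wmon k l - wmon (i + k) (j + l)) -
    (wmon k l * wmon i j - wmon (k + i) (l + j)).
  by rewrite [(k + i)%N]addnC [(l + j)%N]addnC opprB addrA subrK.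
have le1 : (r * (i + k) + s * (j + l) <= n + (r + s))%N by nia.
have le2 : (r * (k + i) + s * (l + j) <= n + (r + s))%N by nia.
split=> [|E].
  by apply: filD; [|apply: filN]; apply: fil_wmonM_rem.
rewrite linearB /= !lead_wmonM_rem // [(k + i)%N]addnC [(l + j)%N]addnC -E.
have -> : (r * (i + k) + s * (j + l) == d + e)%N =
    (r * i + s * j == d)%N && (r * k + s * l == e)%N.
  by apply/eqP/andP => [E'|[/eqP E1 /eqP E2]]; [split; apply/eqP; nia | nia].
rewrite !lead_wmon; have [E1|_] := eqVneq; last first.
  by rewrite /= subrr scaler0 deriv0 !mul0r !mul0rn subrr.
have [E2|_] := eqVneq; last by rewrite /= subrr scaler0 deriv0 !mulr0 !mul0rn subrr.
rewrite !derivXn /= mulrnAl mulrnAr -!mulrnA.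
have -> : 'X^(j.-1) * 'X^l *+ (j * e) = 'X^((j + l).-1) *+ (j * e) :> {poly K}.
  by case: (j) => [|j']; rewrite ?mul0n ?mulr0n // -exprD.
have -> : 'X^j * 'X^(l.-1) *+ (l * d) = 'X^((j + l).-1) *+ (l * d) :> {poly K}.
  by case: (l) => [|l']; rewrite ?mul0n ?mulr0n // -exprD addnS.
rewrite -!(scaler_nat _ 'X^_) -!scalerBl scalerA; congr (_ *: _).
by rewrite -E1 -E2 !natrM !natrD !natrM; ring.
Qed.

(** Covers the weights for which d + e - (r + s) would be truncated: two monomials of so small a
    total weight are both powers of p or both powers of q. *)
Lemma lead_comm_small d e u v : (d + e < r + s)%N -> fil d u -> fil e v ->
  bracket d (lead d u) e (lead e v) = 0.
Proof.
rewrite /bracket => lt fu fv; move: u fu; apply: fil_ind => [|c u u' H1 H2|i j leij].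
- by rewrite linear0 deriv0 !mul0r !mul0rn subrr.
- rewrite linearP derivD derivZ !mulrDl !mulrnDl -!scalerAl !scalerMnr.
  by rewrite opprD addrACA -scalerBr H1 H2 scaler0 addr0.
move: v fv; apply: fil_ind => [|c v v' H1 H2|k l lekl].
- by rewrite linear0 deriv0 !mulr0 !mul0rn subrr.
- rewrite [lead e _]linearP derivD derivZ !mulrDr !mulrnDl -!scalerAr !scalerMnr.
  by rewrite opprD addrACA -scalerBr H1 H2 scaler0 addr0.
rewrite !lead_wmon; have [E1|_] := eqVneq; last by rewrite deriv0 !mul0r !mul0rn subrr.
have [E2|_] := eqVneq; last by rewrite deriv0 !mulr0 !mul0rn subrr.
rewrite !derivXn /= mulrnAl mulrnAr -!mulrnA.
have [/eqP|ik] := posnP (i + k); last first.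
  have [/eqP|jl] := posnP (j + l); last by nia.
  by rewrite addn_eq0 => /andP[/eqP-> /eqP->]; rewrite !mul0n !mulr0n subrr.
rewrite addn_eq0 => /andP[/eqP i0 /eqP k0]; rewrite -E1 -E2 i0 k0 !muln0 !add0n.
have [->|j0] := posnP j; first by rewrite !muln0 !mulr0n subrr.
have [->|l0] := posnP l; first by rewrite !mul0n ?muln0 !mulr0n subrr.
rewrite -!exprD (_ : (j.-1 + l)%N = (j + l.-1)%N); last by lia.
by rewrite (_ : (l * (s * j))%N = (j * (s * l))%N) ?subrr //; ring.
Qed.


End Weights.

(** * Leading forms of images of endomorphisms *)

(** Grade K[X] by the residue of s j modulo r. If [g1] is the component of g of the expected
    residue, then a (g - g1) vanishes: its terms have other residues, which a g does not contain. *)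
Lemma quotient_residue (K : fieldType) (a g : {poly K}) r s m k : a != 0 ->
  (forall j, a`_j != 0 -> s * j = m %[mod r]) ->
  (forall j, (a * g)`_j != 0 -> s * j = m + k %[mod r]) ->
  forall j, g`_j != 0 -> s * j = k %[mod r].
Proof.
move=> a0 ra rag.
pose good i := (s * i == k %[mod r])%N.
pose g1 := \poly_(i < size g) (if good i then g`_i else 0).
have g1E i : g1`_i = if good i then g`_i else 0.
  by rewrite coef_poly; case: ltnP => // le; rewrite nth_default ?if_same.
have prod_res b j : (a * b)`_j != 0 -> exists2 i, b`_i != 0 & s * j = m + s * i %[mod r].
  rewrite coefM => nz; apply: contrapT => H; case/negP: nz; apply/eqP/big1 => -[i /= lti] _.
  apply/eqP; rewrite mulf_eq0; apply/norP => -[/ra Ei nzb]; apply: H; exists (j - i)%N => //.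
  have {1}-> : j = (i + (j - i))%N by lia.
  by rewrite mulnDr -modnDml Ei modnDml.
suff g2 : g - g1 = 0.
  move=> j; rewrite -[g](subrK g1) g2 add0r g1E; case: ifP => [/eqP//|]; by rewrite eqxx.
apply: (mulfI a0); rewrite mulr0; apply/polyP => j; rewrite coef0; apply/eqP/negPn/negP => nz.
have [i + Ej] := prod_res _ _ nz.
rewrite coefB g1E; case: ifPn => [_|bad _]; first by rewrite subrr eqxx.
have jbad : ~ (s * j = m + k %[mod r])%N.
  by move=> E; case/negP: bad; rewrite /good -(eqn_modDl m) -Ej E.
move: nz; rewrite mulrBr coefB; apply/negP; rewrite negbK subr_eq0.
have -> : (a * g)`_j = 0 by apply/eqP/negPn/negP => /rag.
rewrite eq_sym; apply/negPn/negP => /prod_res[l +]; rewrite g1E.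
case: ifP => [/eqP good_l _ E|]; last by rewrite eqxx.
by apply: jbad; rewrite E -modnDmr good_l modnDmr.
Qed.

Section Derivations.
Variables (K : fieldType) (A : algType K) (p q : A).
Hypothesis charK : [pchar K] =i pred0.
Hypothesis wA : weyl_axioms p q.
Local Notation wcoef := (wcoef p q).
Local Notation wmon := (wmon p q).
Variable f : {lrmorphism A -> A}.

Lemma mulqXp l : q ^+ l * p = p * q ^+ l + q ^+ l.-1 *+ l.
Proof.
elim: l => [|l IHl]; first by rewrite mul1r mulr1 addr0.
have qp : q * p = p * q + 1 by rewrite -(weyl_axiom_comm wA) addrC subrK.
rewrite exprS -mulrA IHl mulrDr mulrA qp mulrDl mul1r -mulrA -addrA; congr (_ + _).
rewrite mulrS mulrnAr; congr (_ + _); by case: l {IHl} => // l; rewrite -exprS.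
Qed.

Lemma wcoef_comm_q i j u : wcoef i j (q * u - u * q) = wcoef i.+1 j u *+ i.+1.
Proof.
elim/(wmon_ind wA): u => [|c k l u IH]; first by rewrite mulr0 mul0r subr0 !linear0 mul0rn.
rewrite mulrDr mulrDl -scalerAl -scalerAr opprD addrACA -scalerBr !linearP /= IH mulrnDl.
congr (_ + _); rewrite -mulrnAr; congr (_ * _).
have -> : wmon k l * q = wmon k l.+1 by rewrite -mulrA -exprSr.
rewrite (mulq_wmon wA) [wmon k _ + _]addrC addrK linearMn /= !(wcoef_wmon wA).
case: k => [|k] /=; first by rewrite mulr0n mul0rn.
by rewrite eqSS; case: eqP => [->|]; rewrite //= ?mul0rn.
Qed.

Lemma wcoef_comm_p i j u : wcoef i j (u * p - p * u) = wcoef i j.+1 u *+ j.+1.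
Proof.
elim/(wmon_ind wA): u => [|c k l u IH]; first by rewrite mulr0 mul0r subr0 !linear0 mul0rn.
rewrite mulrDr mulrDl -scalerAl -scalerAr opprD addrACA -scalerBr !linearP /= IH mulrnDl.
congr (_ + _); rewrite -mulrnAr; congr (_ * _).
have -> : wmon k l * p - p * wmon k l = wmon k l.-1 *+ l.
  rewrite mulp_wmon /wmon -mulrA mulqXp mulrDr mulrA -exprSr addrC addKr.
  by rewrite mulrnAr.
rewrite linearMn /= !(wcoef_wmon wA); case: l => [|l] /=; first by rewrite andbF mulr0n mul0rn.
by rewrite eqSS; case: (eqVneq j l) => [->|]; rewrite ?andbF //= ?mul0rn.
Qed.

Lemma mulrn_eq0K (c : K) n : (c *+ n.+1 == 0) = (c == 0).
Proof. by rewrite -mulr_natr mulf_eq0 (natr_eq0 charK) orbF. Qed.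

(** The kernel is stable under commutators with p and q, which differentiate and so lower the total
    degree. By induction both commutators vanish; in characteristic 0 this leaves a scalar, which f
    fixes. *)
Lemma hom_ker u : f u = 0 -> u = 0.
Proof.
have [d fu] : exists n, forall i j, wcoef i j u != 0 -> (i + j < n)%N.
  have [d fu] := @fil_exists _ _ p q 1 1 isT isT wA u; exists d.+1 => i j /fu.
  by rewrite !mul1n.
elim: d u fu => [|n IHn] u fu fu0.
  by apply: (wcoef_eq0 wA) => i j; apply/eqP/negPn/negP => /fu.
have q0 : q * u - u * q = 0.
  apply: IHn => [i j|]; last by rewrite rmorphB !rmorphM /= fu0 mulr0 mul0r subrr.
  by rewrite wcoef_comm_q mulrn_eq0K => /fu; lia.
have p0 : u * p - p * u = 0.
  apply: IHn => [i j|]; last by rewrite rmorphB !rmorphM /= fu0 mulr0 mul0r subrr.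
  by rewrite wcoef_comm_p mulrn_eq0K => /fu; lia.
have box : u = \sum_(i < 1) \sum_(j < 1) wcoef i j u *: wmon i j.
  apply: (wcoef_box wA) => i j; case: i => [|i]; case: j => [|j] //.
  - by rewrite -(mulrn_eq0K _ j) -wcoef_comm_p p0 linear0 eqxx.
  - by rewrite -(mulrn_eq0K _ i) -wcoef_comm_q q0 linear0 eqxx.
  by rewrite -(mulrn_eq0K _ i) -wcoef_comm_q q0 linear0 eqxx.
rewrite !big_ord1 /wmon mulr1 in box.
move: fu0; rewrite box linearZ rmorph1 /= => /eqP; rewrite scaler_eq0 oner_eq0 orbF => /eqP ->.
by rewrite scale0r.
Qed.

Lemma hom_inj : injective f.
Proof.
move=> u v E; apply/eqP; rewrite -subr_eq0; apply/eqP/hom_ker.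
by rewrite rmorphB /= E subrr.
Qed.

End Derivations.

Section KeyLemma.
Variables (K : closedFieldType) (A : algType K) (p q : A).
Hypothesis charK : [pchar K] =i pred0.
Hypothesis wA : weyl_axioms p q.
Local Notation wcoef := (wcoef p q).
Local Notation wmon := (wmon p q).
Variable f : {lrmorphism A -> A}.
Variables (r s d : nat).
Hypotheses (r0 : (0 < r)%N) (s0 : (0 < s)%N) (d0 : (0 < d)%N).
Local Notation fil := (fil p q r s).
Local Notation lead := (lead p q r s).
Local Notation z := (f q).
Hypothesis fil_z : fil d z.
Local Notation phi := (lead d z).
Hypothesis phi0 : phi != 0.

(* If all leading forms of the image of f commuted with that of z, they would be
   determined up to a scalar by their degree, so the image would grow linearly. *)
Lemma hom_noncommuting : exists u e, fil e (f u) /\ bracket d phi e (lead e (f u)) != 0.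
Proof.
apply: contrapT => Hbad.
have comm0 u e : fil e (f u) -> bracket d phi e (lead e (f u)) = 0.
  by move=> fu; apply/eqP/negPn/negP => nz; apply: Hbad; exists u, e.
(* By [bracket0_size] this index is the degree of any nonzero leading form of weight n in the image,
   so [L n] reads off its top coefficient. *)
pose L n (x : A) := (lead n x)`_(n * (size phi).-1 %/ d).
have L_nz u e : fil e (f u) -> lead e (f u) != 0 -> L e (f u) != 0.
  move=> fu nz; rewrite /L (bracket0_size charK phi0 nz (comm0 u e fu)).
  by rewrite mulKn // -lead_coefE lead_coef_eq0.
have [dw fil_w] := fil_exists r0 s0 wA (f p).
(* The (M + 1)^2 monomials with exponents at most M have images of weight at most M^2. Only M^2 + 1
   functionals [L n] act there, so some nontrivial combination is killed by all of them. *)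
pose M := (d + dw)%N; pose D := (M * M)%N.
have fil_fmon (x : 'I_M.+1 * 'I_M.+1) : fil D (f (wmon x.1 x.2)).
  case: x => -[i lti] [j ltj] /=.
  rewrite /wmon rmorphM !rmorphXn /=.
  apply: (fil_le (d := (dw * i + d * j)%N)); first by rewrite /D /M; nia.
  have [fm _] := mul_fil_lead r0 s0 wA (fil_lead_expr r0 s0 wA i fil_w).1 (fil_lead_expr r0 s0 wA j fil_z).1.
  exact: fm.
pose X := ('I_M.+1 * 'I_M.+1)%type.
pose B := \matrix_(a < #|{: X}|, n < D.+1)
  L n (f (wmon (enum_val a).1 (enum_val a).2)).
have : kermx B != 0.
  rewrite kermx_eq0 /row_free; apply: contraTneq (rank_leq_col B) => ->.
  by rewrite -ltnNge card_prod !card_ord /D; nia.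
case/rowV0Pn=> v /sub_kermxP vB; case/negP; apply/eqP/rowP => a; rewrite mxE.
pose u := \sum_a v 0 a *: wmon (enum_val a).1 (enum_val a).2.
have fil_u : fil D (f u).
  rewrite /u raddf_sum; apply: fil_sum => b _ /=; rewrite linearZ /=.
  exact/filZ/fil_fmon.
have L0 n : (n < D.+1)%N -> L n (f u) = 0.
  move=> lt; have := congr1 (fun x : 'rV_D.+1 => x 0 (Ordinal lt)) vB.
  rewrite !mxE => E; rewrite -[RHS]E /L /u !raddf_sum coef_sum /=.
  by apply: eq_bigr => b _; rewrite !linearZ /= coefZ mxE.
have fu0 : f u = 0.
  apply/eqP/negPn/negP => nz.
  have [e [fe le0]] := fil_lead_exists r0 s0 wA nz.
  have := L_nz u e fe le0; rewrite L0 ?eqxx // ltnS leqNgt; apply/negP => lt.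
  by rewrite (fil_lead0 fil_u lt) eqxx in le0.
have := hom_ker charK wA fu0; rewrite /u => /(congr1 (wcoef (enum_val a).1 (enum_val a).2)).
rewrite linear0 linear_sum (bigD1 a) //= linearZ /= (wcoef_wmon wA) !eqxx mulr1.
rewrite big1 ?addr0 // => b neb; rewrite linearZ /= (wcoef_wmon wA).
rewrite (_ : _ && _ = false) ?mulr0 //; apply: contraNF neb => /andP[/eqP E1 /eqP E2].
apply/eqP/enum_val_inj; move: E1 E2.
by case: (enum_val a) (enum_val b) => [a1 a2] [b1 b2] /= /val_inj -> /val_inj ->.
Qed.

(* g is the form F H / E of the header. *)
Lemma hom_lead_quotient : exists g : {poly K},
  [/\ bracket d phi (r + s) g = phi, (s * (size g).-1 <= r + s)%N &
      forall j, g`_j != 0 -> s * j = s %[mod r]].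
Proof.
have [u0 [e0 [fu0 nz0]]] := hom_noncommuting.
(* The nilpotency order of ad q is measured by the p-degree of u; the commutator with q lowers it,
   so minimality forces the next leading form to commute with phi. *)
pose Q n := `[< exists u e, [/\ forall i j, wcoef i j u != 0 -> (i < n)%N,
  fil e (f u) & bracket d phi e (lead e (f u)) != 0] >].
have exQ : exists n, Q n.
  have [n fn] := @fil_exists _ _ p q 1 1 isT isT wA u0.
  by exists n.+1; apply/asboolP; exists u0, e0; split=> // i j /fn; lia.
have [n /asboolP[u [e [un fu nz]]] nmin] := ex_minnP exQ.
have comm_f : f (q * u - u * q) = z * f u - f u * z by rewrite rmorphB !rmorphM.
have le_rs : (r + s <= d + e)%N.
  rewrite leqNgt; apply: contra nz => lt.
  by apply/eqP; apply: (lead_comm_small r0 s0 wA lt fil_z fu).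
pose m := (d + e - (r + s))%N.
have Em : (d + e)%N = (m + (r + s))%N by rewrite subnK.
have [fil_c] := fil_lead_comm r0 s0 wA (eq_leq Em) fil_z fu.
move=> /(_ Em) lead_c.
have comm_eps : bracket d phi m (bracket d phi e (lead e (f u))) = 0.
  rewrite -lead_c bracketZr; apply/eqP; rewrite scaler_eq0; apply/orP; right.
  apply/negPn/negP => nz1; have : Q n.-1.
    apply/asboolP; exists (q * u - u * q), m; rewrite comm_f; split=> // i j.
    by rewrite (wcoef_comm_q wA) mulrn_eq0K // => /un; lia.
  have n0 : (0 < n)%N.
    rewrite lt0n; apply/eqP => n0; case/negP: nz.
    have -> : u = 0 by apply: (wcoef_eq0 wA) => i j; apply/eqP/negPn/negP => /un; rewrite n0.
    by rewrite !linear0 /bracket deriv0 !mulr0 !mul0rn subrr.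
  by move/nmin; lia.
have sphi : (s * (size phi).-1 <= d)%N.
  by apply: (@lead_size _ _ p q r s d z); rewrite -lead_coefE lead_coef_eq0.
have [g [Eg Bg Sg]] :=
  bracket_quotient charK nz comm_eps (esym Em) d0 (leq_addl r s) sphi.
have lead_res k v j : (lead k v)`_j != 0 -> s * j = k %[mod r].
  by case/lead_coefP=> i <- _; rewrite [(r * i)%N]mulnC modnMDl.
exists g; split=> // j gj; rewrite -(modnDl s r); move: j gj.
apply: (quotient_residue nz (m := m)) => j.
  rewrite -lead_c coefZ mulf_eq0 negb_or => /andP[_]; exact: lead_res.
rewrite Eg coefM -Em => nzj; apply: contrapT => H; case/negP: nzj.
apply/eqP/big1 => -[i /= lti] _; apply/eqP; rewrite mulf_eq0; apply/norP => -[ni nj].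
apply: H; have {1}-> : j = (i + (j - i))%N by lia.
by rewrite mulnDr -modnDm (lead_res _ _ _ ni) (lead_res _ _ _ nj) modnDm.
Qed.

End KeyLemma.

(** * Shears, the swap and the reduction *)

Definition surj (T U : Type) (f : T -> U) := forall y, exists x, f x = y.

Section Endo.
Variables (K : closedFieldType) (A : algType K) (p q : A).
Hypothesis charK : [pchar K] =i pred0.
Hypothesis wA : weyl_axioms p q.
Local Notation wcoef := (wcoef p q).
Local Notation wmon := (wmon p q).
Local Notation fil := (fil p q).
Local Notation lead := (lead p q).
Implicit Types f tau : {lrmorphism A -> A}.

(** In weight (1, s) both q and p^s have weight s, so the shear preserves weights and substitutes y
    + c x^s for y. *)
Lemma shear_lead tau (c : K) s d u : (0 < s)%N ->
  tau p = p -> tau q = q + c *: p ^+ s -> fil 1 s d u ->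
  fil 1 s d (tau u) /\ lead 1 s d (tau u) = lead 1 s d u \Po ('X + c%:P).
Proof.
move=> s0 taup tauq; move: u; apply: fil_ind => // [|a u v [f1 l1] [f2 l2]|i j le].
- by rewrite !linear0 ?comp_poly0; split=> //; apply: fil0.
- rewrite !linearP /= l1 l2 ?comp_polyD ?comp_polyZ; split=> //; exact: filP.
have pE : p = wmon 1 0 by rewrite /wmon mulr1.
have fp : fil 1 s 1 p by rewrite {2}pE; apply: fil_wmon => //; lia.
have lp : lead 1 s 1 p = 1 by rewrite {2}pE lead_wmon // muln0 mul1n eqxx.
have qE : q + c *: p ^+ s = wmon 0 1 + c *: wmon s 0 by rewrite /wmon mulr1 mul1r.
have fq : fil 1 s s (q + c *: p ^+ s).
  by rewrite qE; apply: filD; [|apply: filZ]; apply: fil_wmon => //; lia.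
have lq : lead 1 s s (q + c *: p ^+ s) = 'X + c%:P.
  rewrite qE linearD linearZ /= !lead_wmon // muln0 muln1 mul1n muln0 addn0 add0n eqxx.
  by rewrite expr0 alg_polyC.
have [fpi lpi] := fil_lead_expr (r := 1) isT s0 wA i fp.
have [fqj lqj] := fil_lead_expr (r := 1) isT s0 wA j fq.
have [fm lm] := mul_fil_lead (r := 1) isT s0 wA fpi fqj.
rewrite /wmon rmorphM !rmorphXn /= taup tauq; split; first by apply: fil_le fm; rewrite mul1n in le *.
rewrite -/(wmon i j) lead_wmon //; case: eqP => [E|ne]; last first.
  by rewrite (fil_lead0 fm) ?comp_poly0 //; rewrite mul1n in le ne *; lia.
rewrite -E lm lpi lqj lp lq expr1n mul1r.
by rewrite rmorphXn /= comp_polyX.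
Qed.

(** The monomial x^i y^j goes to (-y)^i x^j, which reverses the coefficients up to sign. *)
Lemma swap_lead tau d u : tau p = - q -> tau q = p -> fil 1 1 d u ->
  fil 1 1 d (tau u) /\ forall k, (k <= d)%N ->
    (lead 1 1 d (tau u))`_k = (-1) ^+ k * (lead 1 1 d u)`_(d - k).
Proof.
move=> taup tauq; move: u; apply: fil_ind => // [|a u v [f1 l1] [f2 l2]|i j le].
- by rewrite !linear0; split=> [|k _]; [apply: fil0 | rewrite !coef0 mulr0].
- rewrite !linearP /=; split=> [|k lek]; first exact: filP.
  by rewrite !(coefD, coefZ) l1 // l2 // mulrDr mulrCA.
have pE : p = wmon 1 0 by rewrite /wmon mulr1.
have qE : q = wmon 0 1 by rewrite /wmon mul1r.
have fp : fil 1 1 1 p by rewrite {2}pE; apply: fil_wmon => //; lia.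
have lp : lead 1 1 1 p = 1 by rewrite {2}pE lead_wmon // muln0 mul1n eqxx.
have fq : fil 1 1 1 (- q) by apply: filN; rewrite {2}qE; apply: fil_wmon => //; lia.
have lq : lead 1 1 1 (- q) = - 'X by rewrite linearN {2}qE /= lead_wmon.
have [fqi lqi] := fil_lead_expr (r := 1) (s := 1) isT isT wA i fq.
have [fpj lpj] := fil_lead_expr (r := 1) (s := 1) isT isT wA j fp.
have [fm lm] := mul_fil_lead (r := 1) (s := 1) isT isT wA fqi fpj.
rewrite !mul1n in fm lm le lqi lpj.
rewrite /wmon rmorphM !rmorphXn /= taup tauq; split; first exact: fil_le fm.
move=> k lek; rewrite -/(wmon i j) lead_wmon // !mul1n; case: eqP => [E|ne]; last first.
  by rewrite (fil_lead0 fm) ?coef0 ?mulr0 //; lia.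
rewrite -{1}E lm lqi lpj lp lq expr1n mulr1 -scaleN1r exprZn coefZ !coefXn.
have -> : (d - k == j)%N = (k == i) by lia.
by case: eqP => [->|]; rewrite ?mulr0.
Qed.

Lemma shear_exists (c : K) s : exists tau, tau p = p /\ tau q = q + c *: p ^+ s.
Proof.
have [|tau [tauq taup]] := weyl_axiom_hom wA (z := q + c *: p ^+ s) (w := p).
  rewrite mulrDl mulrDr opprD addrACA (weyl_axiom_comm wA) -scalerAl -scalerAr.
  by rewrite -exprS -exprSr subrr addr0.
by exists tau.
Qed.

Lemma swap_exists : exists tau, tau p = - q /\ tau q = p.
Proof.
have [|tau [tauq taup]] := weyl_axiom_hom wA (z := p) (w := - q).
  by rewrite mulrN mulNr opprK addrC (weyl_axiom_comm wA).
by exists tau.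
Qed.

(** Injectivity of [tau] cancels it on the left, so f may be composed with shears and the swap. *)
Lemma surj_comp tau f : surj (tau \o f) -> surj f.
Proof.
move=> sf y; have [x /= E] := sf (tau y); exists x.
exact: (hom_inj charK wA E).
Qed.

Lemma surj_gen f : (exists x, f x = p) -> (exists y, f y = q) -> surj f.
Proof.
move=> [x fx] [y fy]; apply: (weyl_axiom_ind wA).
- by exists 1; rewrite rmorph1.
- by move=> u v [u' <-] [v' <-]; exists (u' + v'); rewrite rmorphD.
- by move=> c u [u' <-]; exists (c *: u'); rewrite linearZ.
- by move=> u [u' <-]; exists (x * u'); rewrite rmorphM /= fx.
- by move=> u [u' <-]; exists (y * u'); rewrite rmorphM /= fy.
Qed.

Lemma hom_comm f : f q * f p - f p * f q = 1.
Proof. by rewrite -!rmorphM -rmorphB (weyl_axiom_comm wA) rmorph1. Qed.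

Lemma hom_q_neq0 f : f q != 0.
Proof.
apply/eqP => fq0; have /eqP := hom_comm f.
by rewrite fq0 mul0r mulr0 subrr eq_sym oner_eq0.
Qed.

Lemma hom_q_pos f r s d : (0 < r)%N -> (0 < s)%N -> fil r s d (f q) -> (0 < d)%N.
Proof.
move=> r0 s0 fd; rewrite lt0n; apply/eqP => d0.
have E : f q = \sum_(i < 1) \sum_(j < 1) wcoef i j (f q) *: wmon i j.
  by apply: (wcoef_box wA) => i j /fd; rewrite d0; nia.
rewrite !big_ord1 /wmon mulr1 in E.
have /eqP := hom_comm f; rewrite E -scalerAl -scalerAr mul1r mulr1 subrr.
by rewrite eq_sym oner_eq0.
Qed.

Lemma wcoef_poly_p u : (forall i j, wcoef i j u != 0 -> j = 0%N) ->
  exists m (c : nat -> K), u = \sum_(i < m) c i *: p ^+ i.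
Proof.
move=> u0; have [m fm] := @fil_exists _ _ p q 1 1 isT isT wA u.
exists m.+1, (fun i => wcoef i 0 u); rewrite [LHS](wcoef_box (m := m) (n := 0) wA).
  by apply: eq_bigr => i _; rewrite big_ord1 /wmon mulr1.
by move=> i j nz; have := u0 _ _ nz; have := fm _ _ nz; lia.
Qed.

(** If f q is a polynomial in p, comparing leading forms in f q f p - f p f q = 1 shows f q = a p +
    b and f p = c q + (polynomial in p) with a, c nonzero; then p and q lie in the image. *)
Lemma surj_linear f : (forall i j, wcoef i j (f q) != 0 -> j = 0%N) -> surj f.
Proof.
move=> qfree; have fpq := hom_comm f.
have [e fe] := @fil_exists _ _ p q 1 1 isT isT wA (f p).
(* Exceeding the total degree of f p, this weight makes the leading form of f p have its highest
   power of q. *)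
pose s := e.+1; have s0 : (0 < s)%N by [].
have [d [fd ld]] := @fil_lead_exists _ _ p q 1 s isT s0 wA _ (hom_q_neq0 f).
have d0 : (0 < d)%N by apply: (hom_q_pos (r := 1) (s := s) _ _ fd).
have p0 : f p != 0.
  by apply/eqP => E; move/eqP: fpq; rewrite E mul0r mulr0 subrr eq_sym oner_eq0.
have [d' [fd' ld']] := @fil_lead_exists _ _ p q 1 s isT s0 wA _ p0.
set phi := lead 1 s d (f q) in ld; set h := lead 1 s d' (f p) in ld'.
have phiE : phi = (phi`_0)%:P.
  apply/polyP => j; rewrite coefC; case: j => [|j] //=; apply/eqP/negPn/negP.
  by case/lead_coefP => i _ /qfree.
have phi0 : phi`_0 != 0 by apply: contraNneq ld => E; rewrite phiE E.
have [J nzJ] : exists J, h`_J != 0.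
  by exists (size h).-1; rewrite -lead_coefE lead_coef_eq0.
have [I EI nzI] := lead_coefP nzJ.
have ltI : (I < s)%N by have := fe _ _ nzI; lia.
(* Otherwise f p would be a polynomial in p as well and commute with f q. *)
have J0 : (0 < J)%N.
  rewrite lt0n; apply/eqP => J0; move/eqP: fpq.
  have [m [c ->]] := wcoef_poly_p qfree.
  have [|m' [c' ->]] := @wcoef_poly_p (f p).
    by move=> i j /fd'; rewrite -EI J0; nia.
  suff -> : (\sum_(i < m) c i *: p ^+ i) * (\sum_(i < m') c' i *: p ^+ i) =
      (\sum_(i < m') c' i *: p ^+ i) * (\sum_(i < m) c i *: p ^+ i).
    by rewrite subrr eq_sym oner_eq0.
  apply: commr_sum => i _; apply: commr_sym; apply: commr_sum => j _.
  by rewrite /GRing.comm -!scalerAl -!scalerAr -!exprD addnC !scalerA mulrC.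
have brE : (bracket d phi d' h)`_J.-1 = - (phi`_0 * h`_J *+ (J * d)).
  rewrite /bracket phiE derivC mul0r mul0rn sub0r coefN coefMn coefCM coef_deriv prednK //.
  by rewrite mulrnAr -mulrnA coefC eqxx.
have br0 : (bracket d phi d' h)`_J.-1 != 0.
  rewrite brE oppr_eq0 -mulr_natr !mulf_eq0 (negbTE phi0) (negbTE nzJ) natr_eq0 //=.
  by rewrite muln_eq0; lia.
have le_s : (1 + s <= d + d')%N.
  rewrite leqNgt; apply: contra br0 => lt; apply/eqP.
  by rewrite (lead_comm_small (r := 1) (s := s) isT s0 wA lt fd fd') coef0.
pose n := (d + d' - (1 + s))%N.
have En : (d + d')%N = (n + (1 + s))%N by rewrite subnK.
have [_ /(_ En)] := fil_lead_comm (r := 1) (s := s) isT s0 wA (eq_leq En) fd fd'.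
rewrite fpq scale1r -/phi -/h => lead1.
have E1 : 1 = wmon 0 0 by rewrite /wmon mulr1.
have [n0 J1] : n = 0%N /\ J = 1%N.
  move: br0; rewrite -lead1 => /lead_coefP[i Ei]; rewrite E1 (wcoef_wmon wA).
  case: (eqVneq i 0%N) => [i0|]; last by rewrite eqxx.
  case: (eqVneq J.-1 0%N) => [J1 _|]; last by rewrite eqxx.
  by rewrite -Ei i0 J1 !muln0; split=> //; lia.
have [d1 I0] : d = 1%N /\ I = 0%N by nia.
have zE : f q = wcoef 0 0 (f q) *: 1 + wcoef 1 0 (f q) *: p.
  rewrite [LHS](wcoef_box (m := 1) (n := 0) wA).
    by rewrite big_ord_recl !big_ord1 /= /wmon !mulr1.
  by move=> i j nz; have := qfree _ _ nz; have := fd _ _ nz; lia.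
have a0 : wcoef 1 0 (f q) != 0.
  by rewrite -(@coef_lead _ _ p q 1 s isT s0 d (f q) 1 0) // muln0 d1.
have [x0 fx0] : exists x, f x = p.
  move: (wcoef 0 0 (f q)) (wcoef 1 0 (f q)) zE a0 => b a zE a0.
  exists (a^-1 *: (q - b *: 1)).
  by rewrite linearZ linearB linearZ /= rmorph1 zE addrC addKr scalerA mulVf // scale1r.
have c0 : wcoef 0 1 (f p) != 0 by rewrite I0 J1 in nzI.
have [|m [c wE]] := @wcoef_poly_p (f p - wcoef 0 1 (f p) *: q).
  have qE : q = wmon 0 1 by rewrite /wmon mul1r.
  have cq i j : wcoef i j q = ((i == 0%N) && (j == 1%N))%:R.
    by rewrite -(wcoef_wmon wA i j 0 1) -qE.
  move=> i j; rewrite linearB linearZ /= cq => nz.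
  have [//|j0] := posnP j; case/negP: nz; case: (eqVneq j 1%N) => [->|nej].
    case: (eqVneq i 0%N) => [->|nei]; first by rewrite mulr1 subrr.
    rewrite mulr0 subr0; apply/negPn/negP => /fd'; rewrite -EI I0 J1 mul1n muln0 add0n muln1.
    by move: nei; clear; lia.
  rewrite andbF mulr0 subr0; apply/negPn/negP => /fd'; rewrite -EI I0 J1 mul1n muln0 add0n muln1.
  by move: j0 nej s0; clear; nia.
apply: surj_gen; first by exists x0.
exists ((wcoef 0 1 (f p))^-1 *: (p - \sum_(i < m) c i *: x0 ^+ i)).
rewrite linearZ rmorphB /= raddf_sum /=.
have -> : \sum_(i < m) f (c i *: x0 ^+ i) = f p - wcoef 0 1 (f p) *: q.
  by rewrite wE; apply: eq_bigr => i _; rewrite linearZ rmorphXn /= fx0.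
by rewrite subKr scalerA mulVf // scale1r.
Qed.

End Endo.

(** * Normal form of the leading form and descent on the total degree *)

Section Main.
Variables (K : closedFieldType) (A : algType K) (p q : A).
Hypothesis charK : [pchar K] =i pred0.
Hypothesis wA : weyl_axioms p q.
Local Notation wcoef := (wcoef p q).
Local Notation wmon := (wmon p q).
Local Notation fil := (fil p q).
Local Notation lead := (lead p q).
Implicit Types f tau : {lrmorphism A -> A}.

Lemma lead_quotient11 f d : fil 1 1 d (f q) -> lead 1 1 d (f q) != 0 -> exists2 g,
  bracket d (lead 1 1 d (f q)) 2 g = lead 1 1 d (f q) & ((size g).-1 <= 2)%N.
Proof.
move=> fd ld; have d0 : (0 < d)%N by apply: (hom_q_pos wA _ _ fd).
have [g [Eg + _]] := @hom_lead_quotient K A p q charK wA f 1 1 d isT isT d0 fd ld.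
by rewrite mul1n => sg; exists g.
Qed.

Lemma coef_lead_le d u j : (lead 1 1 d u)`_j != 0 -> (j <= d)%N.
Proof. by move/lead_size; rewrite mul1n. Qed.

Lemma shear_root phi (x : K) : root phi x -> (phi \Po ('X + x%:P))`_0 = 0.
Proof. by move/rootP => phix; rewrite -horner_coef0 horner_comp !hornerE. Qed.

Lemma size_shear (phi : {poly K}) (x : K) : size (phi \Po ('X + x%:P)) = size phi.
Proof. by rewrite size_comp_poly2 // size_XaddC. Qed.

(** [mono] turns a monomial with 2 b > d around by the swap. [divx] treats forms divisible by x:
    either c x^d, or a shear moves a root to 0 and [shape_diagonal] applies. In general a shear
    makes the form divisible by y, and the swap then makes it divisible by x. *)
Lemma surj_of_normal d :
  (forall f b c, fil 1 1 d (f q) -> lead 1 1 d (f q) = c *: 'X^b -> c != 0 ->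
     (2 * b < d)%N -> surj f) ->
  forall f, fil 1 1 d (f q) -> lead 1 1 d (f q) != 0 -> surj f.
Proof.
move=> H.
have [sw [swp swq]] := swap_exists wA.
have mono f b c : fil 1 1 d (f q) -> lead 1 1 d (f q) = c *: 'X^b -> c != 0 ->
    (2 * b != d)%N -> surj f.
  move=> fd lE c0; rewrite neq_ltn => /orP[|lt]; first exact: (H _ _ _ fd lE).
  have bd : (b <= d)%N.
    by apply: (@coef_lead_le d (f q)); rewrite lE coefZ coefXn eqxx mulr1.
  have [fs ls] := swap_lead wA swp swq fd.
  apply: (@surj_comp _ _ _ _ charK wA sw).
  pose f' : {lrmorphism A -> A} := sw \o f.
  apply: (H f' (d - b)%N ((-1) ^+ (d - b) * c) fs); last by lia.
    apply/polyP => k; rewrite coefZ coefXn; have [le|lt'] := leqP k d; last first.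
      rewrite (_ : (k == d - b)%N = false) ?mulr0; last lia.
      by apply/eqP/negPn/negP => /coef_lead_le; lia.
    rewrite ls // lE coefZ coefXn (_ : (d - k == b)%N = (k == d - b)%N); last lia.
    by case: eqP => [->|]; rewrite ?mulr0 ?mulr1.
  by rewrite mulf_neq0 // signr_eq0.
have divx f : fil 1 1 d (f q) -> lead 1 1 d (f q) != 0 ->
    (size (lead 1 1 d (f q)) <= d)%N -> surj f.
  move=> fd ld sd; have [/size_poly1P[c c0 lE]|] := boolP (size (lead 1 1 d (f q)) == 1%N).
    apply: (H f 0%N c fd) => //; first by rewrite lE expr0 alg_polyC.
    by apply: (hom_q_pos wA _ _ fd).
  case/closed_rootP => x rx.
  have [tau [taup tauq]] := shear_exists wA x 1.
  have [ft lt] := shear_lead (s := 1) wA isT taup tauq fd.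
  apply: (@surj_comp _ _ _ _ charK wA tau).
  pose f' : {lrmorphism A -> A} := tau \o f.
  have lt0 : lead 1 1 d (f' q) != 0 by rewrite lt -size_poly_eq0 size_shear size_poly_eq0.
  have [g Eg sg] := lead_quotient11 (f := f') ft lt0.
  have [b nzb] : exists b, (lead 1 1 d (f' q))`_b != 0.
    by exists (size (lead 1 1 d (f' q))).-1; rewrite -lead_coefE lead_coef_eq0.
  have [||lE neb] := shape_diagonal charK Eg sg _ _ nzb.
  - by rewrite lt shear_root.
  - by rewrite lt size_shear.
  exact: (mono f' b _ ft lE nzb neb).
move=> f fd ld; have d0 : (0 < d)%N by apply: (hom_q_pos wA _ _ fd).
have [|lt_d] := leqP (size (lead 1 1 d (f q))) d; first exact: divx.
have : size (lead 1 1 d (f q)) != 1%N by move: lt_d; lia.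
case/closed_rootP => x rx.
have [tau [taup tauq]] := shear_exists wA x 1.
have [ft lt] := shear_lead (s := 1) wA isT taup tauq fd.
have [fs ls] := swap_lead wA swp swq ft.
apply: (@surj_comp _ _ _ _ charK wA tau); apply: (@surj_comp _ _ _ _ charK wA sw (tau \o f)).
pose f' : {lrmorphism A -> A} := sw \o (tau \o f).
apply: (divx f' fs).
  have lt0 : lead 1 1 d (tau (f q)) != 0 by rewrite lt -size_poly_eq0 size_shear size_poly_eq0.
  have [b nzb] : exists b, (lead 1 1 d (tau (f q)))`_b != 0.
    by exists (size (lead 1 1 d (tau (f q)))).-1; rewrite -lead_coefE lead_coef_eq0.
  have bd := coef_lead_le nzb.
  apply: contraNneq nzb => l0; have := ls (d - b)%N (leq_subr _ _).
  rewrite l0 coef0 subKn // => /esym/eqP; rewrite mulf_eq0 signr_eq0 /= => /eqP ->.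
  by [].
apply/leq_sizeP => j le; apply/eqP/negPn/negP => nz; have le' := coef_lead_le nz.
have jd : j = d by lia.
by move: nz; rewrite jd /f' /= ls // subnn lt shear_root // mulr0 eqxx.
Qed.

(** Induction on a bound for the total degree of f q. With leading form c x^a y^b, a > b, either f q
    fits in the box (a, b) or an upward edge permits a shear to smaller degree. *)
Lemma surj_main n :
  (forall k l (a : nat -> nat -> K) (z w : A), (l < k)%N -> (1 <= l)%N -> a k l != 0 ->
     z = \sum_(i < k.+1) \sum_(j < l.+1) a i j *: wmon i j -> z * w - w * z = 1 -> False) ->
  forall f, fil 1 1 n (f q) -> surj f.
Proof.
move=> Hno; elim/ltn_ind: n => n IH f0 f0n.
have [d [fd0 ld0]] := @fil_lead_exists _ _ p q 1 1 isT isT wA _ (hom_q_neq0 wA f0).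
have le_dn : (d <= n)%N.
  by rewrite leqNgt; apply: contra ld0 => lt; rewrite (fil_lead0 f0n lt).
move: f0 fd0 ld0 {f0n} => f0 fd0 ld0.
apply: (surj_of_normal _ fd0 ld0) => {f0 fd0 ld0} f b c fd lE c0 lt_bd.
pose S i j := wcoef i j (f q) != 0.
pose a := (d - b)%N; have ab : (a + b)%N = d by rewrite /a; lia.
have lt_ba : (b < a)%N by lia.
have Sab : S a b.
  by rewrite /S -(@coef_lead _ _ p q 1 1 isT isT d) ?lE ?coefZ ?coefXn ?eqxx ?mulr1 //; lia.
have tot i j : S i j -> (i + j <= a + b)%N by move/fd; lia.
have top i j : S i j -> (i + j = a + b)%N -> j = b.
  move=> Sij E; apply/eqP; apply: contraTT Sij => ne; rewrite /S negbK.
  by rewrite -(@coef_lead _ _ p q 1 1 isT isT d) ?lE ?coefZ ?coefXn ?(negbTE ne) ?mulr0 //; lia.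
have le_a i j : S i j -> (i <= a)%N.
  move=> S0; rewrite leqNgt; apply/negP => lt0.
  have [|r [s [i1 [j1 [cop rs S1 [lt1 E1] below]]]]] := newton_edge tot _ S0 lt0.
    by move=> i' j' S' E'; have := top _ _ S' E'; lia.
  have [r0 s0] : (0 < r)%N /\ (0 < s)%N by lia.
  have fe : fil r s (r * a + s * b) (f q) by move=> i' j' /below[].
  have nzb : (lead r s (r * a + s * b) (f q))`_b != 0.
    by rewrite (@coef_lead _ _ p q r s r0 s0 _ (f q) a b erefl).
  have nzj : (lead r s (r * a + s * b) (f q))`_j1 != 0.
    by rewrite (@coef_lead _ _ p q r s r0 s0 _ (f q) i1 j1 E1).
  have l0 : lead r s (r * a + s * b) (f q) != 0 by apply: contraNneq nzb => ->; rewrite coef0.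
  have [|g [Eg sg rg]] := hom_lead_quotient charK wA r0 s0 _ fe l0; first by nia.
  (* An edge to the right would make the form a pure power of y, contradicting a > 0. *)
  have bE : b = (r * a + s * b)%N.
    apply: (shape_shallow charK cop rs Eg sg rg nzb nzj); first by nia.
    apply/leq_sizeP => k lt_bk; apply/eqP/negPn/negP => /lead_coefP[i' Ei' Si'].
    by have [_ /(_ Ei')] := below _ _ Si'; lia.
  by nia.
have [[i0 [j0 [S0 lt0]]]|no_up] := pselect (exists i j, S i j /\ (b < j)%N).
  (* [newton_edge] with the two axes exchanged: now r < s. *)
  have [||s [r [j1 [i1 [cop rs S1 [lt1 E1] below]]]]] :=
    @newton_edge (fun j i => S i j) b a j0 i0 _ _ S0 lt0.
  - by move=> j i /tot; lia.
  - by move=> j i /top; lia.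
  rewrite coprime_sym in cop.
  have [r0 s0] : (0 < r)%N /\ (0 < s)%N by lia.
  have fe : fil r s (r * a + s * b) (f q) by move=> i' j' /below[]; lia.
  have nzb : (lead r s (r * a + s * b) (f q))`_b != 0.
    by rewrite (@coef_lead _ _ p q r s r0 s0 _ (f q) a b erefl).
  have nzj : (lead r s (r * a + s * b) (f q))`_j1 != 0.
    by rewrite (@coef_lead _ _ p q r s r0 s0 _ (f q) i1 j1) //; lia.
  have l0 : lead r s (r * a + s * b) (f q) != 0 by apply: contraNneq nzb => ->; rewrite coef0.
  have [|g [Eg sg rg]] := hom_lead_quotient charK wA r0 s0 _ fe l0; first by nia.
  have [k lt_kb|b0 r1] := shape_steep charK cop rs Eg sg rg nzb nzj lt1.
    apply/eqP/negPn/negP => /lead_coefP[i' Ei' Si'].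
    have [_ H] := below _ _ Si'; have {}H : (i' <= a)%N by apply: H; lia.
    by nia.
  have ad : (r * a + s * b = d)%N by rewrite b0 r1; lia.
  rewrite ad r1 in fe nzb nzj l0 *.
  (* The edge point has q-degree j1 > b = 0, so the form is nonconstant and has a root; shearing by
     that root removes p^d. *)
  have : size (lead 1 s d (f q)) != 1%N.
    apply/eqP => sz; case/negP: nzj; rewrite nth_default // sz; lia.
  case/closed_rootP => x rx.
  have [tau [taup tauq]] := shear_exists wA x s.
  have [ft lt] := shear_lead wA s0 taup tauq fe.
  apply: (@surj_comp _ _ _ _ charK wA tau).
  pose f' : {lrmorphism A -> A} := tau \o f.
  have d0 : (0 < d)%N by rewrite -ad; nia.
  apply: (IH d.-1 _ f'); first by rewrite prednK.
  move=> i j nz; have le := ft _ _ nz.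
  have s2 : (1 < s)%N by move: rs; rewrite r1 => /andP[].
  (* Apart from (d, 0), whose coefficient is now 0, i + s j <= d with s >= 2 implies i + j < d. *)
  have ne0 : (i != d) || (0 < j)%N.
    rewrite lt0n -negb_and; apply: contra nz => /andP[/eqP id /eqP j00].
    rewrite -(@coef_lead _ _ p q 1 s isT s0 d); last by rewrite id j00 mul1n muln0 addn0.
    by rewrite j00 /f' /= lt shear_root.
  rewrite mul1n in le; rewrite !mul1n.
  have : (2 * j <= s * j)%N by rewrite leq_mul2r s2 orbT.
  move: le ne0 d0; clear; lia.
have le_b i j : S i j -> (j <= b)%N.
  by move=> Sij; rewrite leqNgt; apply/negP => lt; apply: no_up; exists i, j.
have [b0|b0] := posnP b.
  by apply: (surj_linear charK wA) => i j /le_b; rewrite b0; lia.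
case: (Hno a b (fun i j => wcoef i j (f q)) (f q) (f p)) => //.
  by apply: (wcoef_box wA) => i j Sij; rewrite (le_a _ _ Sij) (le_b _ _ Sij).
exact: hom_comm.
Qed.

End Main.

(** * Elements of a box are not locally ad-nilpotent *)

Section Corner.
Variables (K : fieldType) (A : algType K) (p q : A).
Hypothesis charK : [pchar K] =i pred0.
Hypothesis wA : weyl_axioms p q.
Local Notation wcoef := (wcoef p q).
Local Notation wmon := (wmon p q).
Local Notation fil := (fil p q 1 1).
Local Notation lead := (lead p q 1 1).

Definition ad (x y : A) : A := x * y - y * x.

Lemma ad_q_nilpotent u : exists m, iter m (ad q) u = 0.
Proof.
have [m um] : exists m, forall i j, wcoef i j u != 0 -> (i < m)%N.
  have [m um] := fil_exists (r := 1) (s := 1) isT isT wA u.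
  by exists m.+1 => i j /um; lia.
exists m; elim: m u um => [|m IHm] u um.
  by apply: (wcoef_eq0 wA) => i j; apply/eqP/negPn/negP => /um.
rewrite iterSr; apply: IHm => i j; rewrite (wcoef_comm_q wA) => nz.
have /um : wcoef i.+1 j u != 0 by apply: contraNneq nz => ->; rewrite mul0rn.
by [].
Qed.

(** The leading form of (ad z)^m p is a nonzero multiple of x^(1 + m (k - 1)) y^(m (n - 1)). *)
Lemma corner_ad_nonzero z k n c : (n < k)%N -> (0 < n)%N -> c != 0 ->
  fil (k + n) z -> lead (k + n) z = c *: 'X^n -> forall m, iter m (ad z) p != 0.
Proof.
move=> nk n0 c0 fz lz m.
have [k' kE] : exists k', k = k'.+1 by exists k.-1; lia.
have [n' nE] : exists n', n = n'.+1 by exists n.-1; lia.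
suff [c' [c'0 fm lm]] : exists c', [/\ c' != 0,
    fil (1 + m * k' + m * n') (iter m (ad z) p) &
    lead (1 + m * k' + m * n') (iter m (ad z) p) = c' *: 'X^(m * n')].
  apply/eqP => E; move/eqP: lm; rewrite E linear0 eq_sym scaler_eq0 (negbTE c'0).
  by rewrite -size_poly_eq0 size_polyXn.
elim: m => [|m [c' [c'0 fm lm]]].
  exists 1; have pE : p = wmon 1 0 by rewrite /wmon mulr1.
  rewrite !mul0n !addn0 /= expr0 scale1r; split; first exact: oner_neq0.
    by rewrite [X in fil _ X]pE; apply: fil_wmon.
  by rewrite [X in lead _ X]pE lead_wmon.
have En : (k + n + (1 + m * k' + m * n') = (1 + m.+1 * k' + m.+1 * n') + (1 + 1))%N.
  by rewrite kE nE; lia.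
have [fc /(_ En)] := fil_lead_comm (r := 1) (s := 1) isT isT wA (eq_leq En) fz fm.
rewrite scale1r lz lm => lc.
(* The difference of the two numerals equals n + m (k - n), which is positive since k > n. *)
exists (c * c' * ((n * (1 + m * k' + m * n'))%:R - (m * n' * (k + n))%:R)); split.
- rewrite !mulf_neq0 // subr_eq0 natr_inj //; apply/eqP; nia.
- exact: fc.
rewrite iterS -[ad z _]/(z * _ - _ * z) lc bracket_monomial //.
by congr (_ *: 'X^_); rewrite nE; lia.
Qed.

(* If f q = z, then ad z inherits local nilpotency on the image of f from ad q. *)
Lemma corner_not_surj (f : {lrmorphism A -> A}) k n (a : nat -> nat -> K) :
  (n < k)%N -> (0 < n)%N -> a k n != 0 ->
  f q = \sum_(i < k.+1) \sum_(j < n.+1) a i j *: wmon i j -> ~ surj f.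
Proof.
move=> nk n0 akn zE sf.
have zcoef i j : wcoef i j (f q) != 0 -> (i <= k)%N && (j <= n)%N.
  apply: contraR; rewrite negb_and -!ltnNge => out.
  by rewrite zE (wcoef_weyl_sum_out wA).
have fz : fil (k + n) (f q) by move=> i j /zcoef; lia.
have lz : lead (k + n) (f q) = a k n *: 'X^n.
  apply/polyP => j; rewrite coefZ coefXn; case: (eqVneq j n) => [->|ne].
    rewrite mulr1 (@coef_lead _ _ p q 1 1 isT isT (k + n) (f q) k n); last lia.
    by rewrite zE (wcoef_weyl_sum wA).
  rewrite mulr0; apply/eqP/negPn/negP => /lead_coefP[i Ei /zcoef]; lia.
have [u fu] := sf p; have [m um] := ad_q_nilpotent u.
have /eqP := corner_ad_nonzero nk n0 akn fz lz m; apply.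
suff <- : f (iter m (ad q) u) = iter m (ad (f q)) p by rewrite um linear0.
by elim: {um} m => // m IHm; rewrite !iterS -IHm /ad rmorphB !rmorphM.
Qed.

End Corner.

(** * The Dixmier conjecture and the boxes *)

Local Open Scope classical_set_scope.

Theorem proposition3p2 (K : closedFieldType) (charK : [pchar K]%R =i pred0) :
  dixmier_conjecture K <->
  forall k n : nat, (n < k)%N -> (1 <= n)%N ->
    weyl_box K k n `&` weyl_Gamma K = set0.
Proof.
have wA := weyl_axioms_weyl charK; split=> [DC k n nk n0|Hno f].
  rewrite -subset0 => z [[a [akn zE]] [w zw]] /=.
  (* The partner w makes z the image of q under an endomorphism, which the conjecture makes
     surjective. *)
  have [f [fq fp]] := weyl_hom_exists zw.
  apply: (corner_not_surj charK wA (f := f) nk n0 akn); first by rewrite fq.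
  by move=> y; have [g _ gK] := DC f; exists (g y).
have [n fn] := fil_exists (r := 1) (s := 1) isT isT wA (f (weyl_q K)).
have sf : surj f.
  apply: (surj_main charK wA _ fn) => k l a z w lk l0 akl zE zw.
  have := Hno k l lk l0; rewrite -subset0 => /(_ z); apply; split; first by exists a.
  by exists w.
exists (fun y => projT1 (cid (sf y))) => [x|y]; last by case: cid.
by apply: (hom_inj charK wA (f := f)); case: cid.
Qed.
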